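(* Let $N\ge 2$ and let $\mathscr{O}_{1,2}$ be the off-diagonal overlap associated with the eigenvalues $\lambda_1,\lambda_2$ of a matrix distributed according to the spherical ensemble $\mathrm{Sph}(N)$. The quenched expectation of $\mathscr{O}_{1,2}$, that is, its conditional expectation with respect to the spectrum $\Lambda=(\lambda_1,\dots,\lambda_N)$, is given by the formula $$\mathbb{E}_\Lambda(\mathscr{O}_{1,2})=-\frac{1}{N|\lambda_1-\lambda_2|^2}\prod_{k=3}^N\left(1+\frac{(1+\lambda_1\overline{\lambda_2})(1+|\lambda_k|^2)}{N(\lambda_1-\lambda_k)\,(\overline{\lambda_2-\lambda_k})}\right).$$
   Context: $\mathrm{Sph}(N)$ is the law of $G=G_1G_2^{-1}$, where $G_1,G_2$ are independent $N\times N$ complex Ginibre matrices (i.i.d. centered complex Gaussian entries). The spectrum is almost surely simple; the eigenvalues $\lambda_1,\dots,\lambda_N$ are labelled exchangeably (uniformly random labelling). Overlaps: for a matrix $G$ with simple spectrum, let $R_j$ be right eigenvectors (columns) and $L_j$ left eigenvectors (rows) with $GR_j=\lambda_jR_j$, $L_jG=\lambda_jL_j$, $L_iR_j=\delta_{ij}$. Then $\mathscr{O}_{i,j}=(L_iL_j^* )(R_j^*R_i)$; this does not depend on the choice of such eigenvectors and is invariant under unitary change of basis. Schur form and conditioning: $G$ can be written $G=UTU^*$ with $U$ unitary (suitably chosen at random) and $T$ upper triangular with diagonal $(\lambda_1,\dots,\lambda_N)$, such that $T$ has density proportional to $\prod_{i<j}|\lambda_i-\lambda_j|^2\det(I_N+TT^*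 )^{-2N}$ with respect to Lebesgue measure on all diagonal and strictly upper-triangular complex entries. The overlaps of $G$ equal those of $T$. Conditioning on $\Lambda$ means fixing the diagonal of $T$ and renormalizing this density in the strictly upper-triangular entries; $\mathbb{E}_\Lambda$ is the corresponding conditional expectation.
   Formalization: The printed right-hand side lacks the factor (1+|λ₁|²)(1+|λ₂|²); the formal theorem inserts it. For N=2 the true value is −(1+|λ₁|²)(1+|λ₂|²)/(2|λ₁−λ₂|²), so the printed formula fails. *)

(* Defs.v *)
From HB Require Import structures.
From mathcomp Require Import all_boot all_order all_algebra.
From mathcomp Require Import complex.
From mathcomp Require Import all_classical all_reals all_analysis.

Set Implicit Arguments.
Unset Strict Implicit.
Unset Printing Implicit Defensive.

Import Order.TTheory GRing.Theory Num.Theory.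
Import numFieldNormedType.Exports.

Local Open Scope classical_set_scope.
Local Open Scope ring_scope.
Local Open Scope sesquilinear_scope.

Section sigma_finite_product.
Context d1 d2 (T1 : measurableType d1) (T2 : measurableType d2) (R : realType).
Variable m1 : {sigma_finite_measure set T1 -> \bar R}.
Variable m2 : {sigma_finite_measure set T2 -> \bar R}.

(* m1 \x m2 under a name of its own: on the library's constant, unification
   finds only the sigma-finiteness instance for subprobabilities. *)
Definition sigma_finite_product : set (T1 * T2) -> \bar R := (m1 \x m2)%E.

HB.instance Definition _ := Measure.on sigma_finite_product.

Let sigma_finite_productT : sigma_finite setT sigma_finite_product.
Proof.
have /sigma_finiteP[F [TF ndF Foo]] := sigma_finiteT m1.
have /sigma_finiteP[G [TG ndG Goo]] := sigma_finiteT m2.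
exists (fun n => F n `*` G n).
  rewrite -setXTT TF TG predeqE => -[x y]; split.
    move=> [/= [n _ Fnx] [k _ Gky]]; exists (maxn n k) => //; split.
    - by move: x Fnx; exact/subsetPset/ndF/leq_maxl.
    - by move: y Gky; exact/subsetPset/ndG/leq_maxr.
  by move=> [n _ []/= ? ?]; split; exists n.
move=> k; have [? ?] := Foo k; have [? ?] := Goo k.
split; first exact: measurableX.
rewrite /sigma_finite_product product_measure1E//.
by rewrite lte_mul_pinfty// ge0_fin_numE.
Qed.

HB.instance Definition _ := Measure_isSigmaFinite.Build _ _ _
  sigma_finite_product sigma_finite_productT.

End sigma_finite_product.

Section cons_measure.
Context d (T : measurableType d) (R : realType).
Variables (mu : {sigma_finite_measure set T -> \bar R}) (n : nat).
Variable nu : {sigma_finite_measure set (n.-tuple T) -> \bar R}.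

Definition cons_tup (p : T * n.-tuple T) : n.+1.-tuple T := [tuple of p.1 :: p.2].

Lemma measurable_cons_tup : measurable_fun setT cons_tup.
Proof. exact: (measurable_cons measurable_fst measurable_snd). Qed.

Definition cons_measure : set (n.+1.-tuple T) -> \bar R :=
  pushforward (sigma_finite_product mu nu) cons_tup.

Let cons_measure0 : cons_measure set0 = 0%E.
Proof. by rewrite /cons_measure /pushforward preimage_set0 measure0. Qed.

Let cons_measure_ge0 A : (0 <= cons_measure A)%E.
Proof. exact: (measure_ge0 (sigma_finite_product mu nu)). Qed.

Let cons_measure_sigma_additive : semi_sigma_additive cons_measure.
Proof.
move=> F mF tF mUF; rewrite /cons_measure /pushforward preimage_bigcup.
have mpre A : measurable A -> measurable (cons_tup @^-1` A).
  by move=> mA; rewrite -[X in measurable X]setTI; exact: measurable_cons_tup.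
apply: measure_semi_sigma_additive.
- by move=> k; exact: mpre.
- apply/trivIsetP => /= i j _ _ ij; rewrite -preimage_setI.
  by move/trivIsetP : tF => /(_ _ _ _ _ ij) ->//; rewrite preimage_set0.
- by rewrite -preimage_bigcup; exact: mpre.
Qed.

HB.instance Definition _ := isMeasure.Build _ _ _ cons_measure
  cons_measure0 cons_measure_ge0 cons_measure_sigma_additive.

Let cons_measure_sigma_finite : sigma_finite setT cons_measure.
Proof.
have [F FT Ffin] := sigma_finiteT (sigma_finite_product mu nu).
pose g (t : n.+1.-tuple T) : T * n.-tuple T := (thead t, [tuple of behead t]).
have mg : measurable_fun setT g.
  apply/measurable_fun_pairP; split; first exact: measurable_tnth.
  exact: measurable_behead.
have gK : cancel cons_tup g.
  by case=> a t; rewrite /g theadE; congr pair; apply: val_inj.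
exists (fun k => g @^-1` F k).
  by rewrite -preimage_bigcup -FT preimage_setT.
move=> k; have [mF finF] := Ffin k; split.
  by rewrite -[X in measurable X]setTI; exact: mg.
rewrite /cons_measure /pushforward -comp_preimage.
by rewrite (_ : g \o cons_tup = id) //; apply/funext => p /=; rewrite gK.
Qed.

HB.instance Definition _ := Measure_isSigmaFinite.Build _ _ _ cons_measure
  cons_measure_sigma_finite.

End cons_measure.

Fixpoint power_measure d (T : measurableType d) (R : realType)
    (mu : {sigma_finite_measure set T -> \bar R}) (n : nat) :
    {sigma_finite_measure set (n.-tuple T) -> \bar R} :=
  match n with
  | 0 => dirac [tuple]
  | m.+1 => cons_measure mu (power_measure mu m)
  end.

Section sphere.
Variable R : realType.
Local Notation C := (complex R).
Local Notation R2 := (measurableTypeR R * measurableTypeR R)%type.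

(* R[i] carries no sigma-algebra in the library: a complex entry is
   represented by the pair of its real and imaginary parts. *)
Definition lebesgue_complex_power (n : nat) :
    {sigma_finite_measure set (n.-tuple R2) -> \bar R} :=
  power_measure
    (sigma_finite_product (@lebesgue_measure R) (@lebesgue_measure R)) n.

Definition complex_of_pair (z : R2) : C := Complex z.1 z.2.

(* The entry (i, j), i < j, is coordinate 'C(j, 2) + i of x: the strict upper
   triangle is filled column by column, which is a bijection onto
   {0, ..., 'C(N, 2) - 1}. *)
Definition schur_mx (N : nat) (lam : 'I_N -> C)
    (x : 'C(N, 2).-tuple R2) : 'M[C]_N :=
  \matrix_(i, j)
    if (i < j)%N then complex_of_pair (nth (0 : R, 0 : R) x ('C(j, 2) + i))
    else if i == j then lam i else 0.

(* Unnormalized density of the triangular Schur factor of the spherical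
   ensemble; its value is a nonnegative real, so Re only changes the type. *)
Definition schur_density (N : nat) (T : 'M[C]_N) : R :=
  complex.Re ((\prod_(i < N) \prod_(j < N | (i < j)%N) `|T i i - T j j| ^+ 2)
              * (\det (1%:M + T *m T ^t*)) ^- (2 * N)%N).

Section quenched.
Variables (N : nat) (lam : 'I_N -> C) (F : 'M[C]_N -> C).
Let mu := lebesgue_complex_power 'C(N, 2).
Let w x := schur_density (schur_mx lam x).
Let Z : R := \int[mu]_x w x.

Definition quenched_integrable : Prop :=
  [/\ mu.-integrable setT (EFin \o w),
      0 < Z,
      mu.-integrable setT
        (EFin \o (fun x => complex.Re (F (schur_mx lam x)) * w x)) &
      mu.-integrable setT
        (EFin \o (fun x => complex.Im (F (schur_mx lam x)) * w x))].

Definition quenched_expectation : C :=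
  Complex ((\int[mu]_x (complex.Re (F (schur_mx lam x)) * w x)) / Z)
          ((\int[mu]_x (complex.Im (F (schur_mx lam x)) * w x)) / Z).

End quenched.

(* The columns of Rm are right eigenvectors R_j, the rows of Lm left
   eigenvectors L_i, and Lm *m Rm = 1 says L_i R_j = delta_ij. *)
Definition biorthogonal_eigenbasis (N : nat) (G : 'M[C]_N) (lam : 'I_N -> C)
    (Lm Rm : 'M[C]_N) : Prop :=
  [/\ forall j, G *m col j Rm = lam j *: col j Rm,
      forall i, row i Lm *m G = lam i *: row i Lm &
      Lm *m Rm = 1%:M].

Definition is_overlap (N : nat) (G : 'M[C]_N) (lam : 'I_N -> C) (i j : 'I_N)
    (o : C) : Prop :=
  exists Lm Rm : 'M[C]_N, biorthogonal_eigenbasis G lam Lm Rm /\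
    o = (row i Lm *m (row j Lm) ^t*) 0 0 * ((col j Rm) ^t* *m col i Rm) 0 0.

(* The default value 0 is only taken when there is no biorthogonal eigenbasis,
   which cannot happen when G has N distinct eigenvalues lam. *)
Definition overlap (N : nat) (G : 'M[C]_N) (lam : 'I_N -> C) (i j : 'I_N) : C :=
  xget 0 [set o | is_overlap G lam i j o].

End sphere.

(* Main.v *)
(* The quenched law of T is disintegrated one column at a time.  Write
   T_(n+1) = [T_n, u; 0, lambda], H = 1 + T_n T_n^* = L L^* (Cholesky) and u = L v.
   Then det (1 + T_(n+1) T_(n+1)^* ) = det H (1 + |lambda|^2 + |v|^2), so given T_n
   the vector v has density proportional to
   (1 + |lambda|^2 + |v|^2)^-(N + n + 1), whence
   E [u u^* | T_n] = (1 + |lambda|^2) / N * H for every n.  If B and D are left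
   eigenvectors of T_n for lambda_1 and lambda_2, the next coordinate of B is
   B u / (lambda_1 - lambda) (and similarly for D), so that E [. | T_n] multiplies
   B D^* by 1 + (1 + |lambda|^2) (1 + lambda_1 lambda_2^* )
     / (N (lambda_1 - lambda) (lambda_2 - lambda)^* ).
   With b the (1, 2) entry of the left eigenvector matrix, the overlap is
   - B (b D)^*; the first column gives E |b|^2.

   To use Tonelli only, B D^* is never integrated on its own: the recursion is run on
   nonnegative Hermitian forms al |B|^2 + be |D|^2 + 2 Re (ga B D^* ), and B D^* is
   recovered at the end as a difference of two of them. *)

Require Import Defs.
From HB Require Import structures.
From mathcomp Require Import all_boot all_order all_algebra.
From mathcomp Require Import complex.
From mathcomp Require Import all_classical all_reals all_analysis measurable_realfun.
From mathcomp Require Import ring lra.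

Set Implicit Arguments.
Unset Strict Implicit.
Unset Printing Implicit Defensive.

Import Order.TTheory GRing.Theory Num.Theory.
Import numFieldNormedType.Exports.

Local Open Scope ring_scope.
Local Open Scope sesquilinear_scope.

(** * Affine substitutions for Lebesgue measure on the line and the plane *)

Section line.
Variable R : realType.
Local Notation leb := (@lebesgue_measure R).
Local Open Scope classical_set_scope.

Local Notation aff c b :=
  (fun x : measurableTypeR R => (c * x + b)%R : measurableTypeR R).

(** The induction is on the size n with k + 1 = N held fixed. The weight of T_n has exponent n + k +
    1, which is 2N at n = N and drops by one per integrated column: the Jacobian of u = L v gives
    back one power of det H. A triangular L, rather than a Hermitian square root, reduces this
    substitution to affine changes of one complex variable at a time. The plane integrals of (1 +
    |z|^2)^-p are never evaluated. They are shown to be positive and finite with a known ratio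
    between consecutive ones, and their product cancels against the partition function. This
    requires one constant valid for the partition function and for all forms, which is why a real
    number r >= 0 travels beside the form. The same r absorbs, at each step, the part of the form
    that the earlier columns have already fixed. *)

Lemma measurable_affine (c b : R) :
  measurable_fun setT (aff c b).
Proof.
by apply: measurable_funD => //; exact: measurable_funM.
Qed.

Lemma affine_preimage_ocitv (c b u v : R) : 0 < c ->
  (fun x : R => c * x + b) @^-1` `]u, v] = `](u - b) / c, (v - b) / c].
Proof.
move=> c0; apply/seteqP; split=> x /=; rewrite !in_itv/=.
  by rewrite ltr_pdivrMr// ler_pdivlMr// ltrBlDr lerBrDr ![x * c]mulrC.
by rewrite ltr_pdivrMr// ler_pdivlMr// ltrBlDr lerBrDr ![x * c]mulrC.
Qed.

(** Lebesgue measure is determined by its values on half-open intervals, and there the two sides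
    agree. *)
Lemma lebesgue_measure_affine (c b : R) (A : set (measurableTypeR R)) : 0 < c ->
  measurable A -> leb A = (c%:E * pushforward leb (aff c b) A)%E.
Proof.
move=> c0 mA.
pose phi : {mfun measurableTypeR R >-> measurableTypeR R} :=
  HB.pack (aff c b)
    (isMeasurableFun.Build _ _ _ _ _ (measurable_affine c b)).
have := @lebesgue_measure_unique R (mscale (NngNum (ltW c0)) (pushforward leb phi)).
apply => //= _ [[u v]] _ <-.
rewrite /mscale/= /pushforward affine_preimage_ocitv// !lebesgue_measure_itv/=.
rewrite !lte_fin ltr_pM2r ?invr_gt0// ltrD2r.
case: ifPn => _; last by rewrite mule0.
rewrite -EFinD; congr (_%:E); field; exact: lt0r_neq0.
Qed.

Lemma ge0_integral_affine (c b : R) (f : measurableTypeR R -> \bar R) : 0 < c ->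
  measurable_fun setT f -> (forall x, 0 <= f x)%E ->
  (\int[leb]_x f x = c%:E * \int[leb]_x f (aff c b x))%E.
Proof.
move=> c0 mf f0.
pose phi : {mfun measurableTypeR R >-> measurableTypeR R} :=
  HB.pack (aff c b)
    (isMeasurableFun.Build _ _ _ _ _ (measurable_affine c b)).
rewrite (eq_measure_integral (mscale (NngNum (ltW c0)) (pushforward leb phi))); last first.
  by move=> A mA _; exact: lebesgue_measure_affine.
rewrite ge0_integral_mscale//= ge0_integral_pushforward//.
exact: measurable_affine.
Qed.

Lemma ge0_integral_opp (f : measurableTypeR R -> \bar R) :
  measurable_fun setT f -> (forall x, 0 <= f x)%E ->
  (\int[leb]_x f x = \int[leb]_x f (- x)%R)%E.
Proof.
move=> mf f0.
transitivity (\int[pushforward leb (-%R : _ -> measurableTypeR R)]_x f x)%E.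
  by apply: eq_measure_integral => A mA _; exact/esym/lebesgue_measureN.
by rewrite ge0_integral_pushforward.
Qed.

End line.

Section plane.
Variable R : realType.
Local Notation leb := (@lebesgue_measure R).
Local Notation R2 := (measurableTypeR R * measurableTypeR R)%type.
Local Open Scope classical_set_scope.

Local Notation leb2 := (sigma_finite_product leb leb).

Lemma ge0_integral_leb2 (f : R2 -> \bar R) :
  measurable_fun setT f -> (forall x, 0 <= f x)%E ->
  (\int[leb2]_z f z = \int[leb]_x \int[leb]_y f (x, y))%E.
Proof. by move=> mf f0; rewrite /sigma_finite_product fubini_tonelli1. Qed.

Lemma ge0_integral_leb2_affine (c b1 b2 : R) (f : R2 -> \bar R) : 0 < c ->
  measurable_fun setT f -> (forall x, 0 <= f x)%E ->
  (\int[leb2]_z f z =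
   (c ^+ 2)%:E * \int[leb2]_z f ((c * z.1 + b1)%R, (c * z.2 + b2)%R))%E.
Proof.
move=> c0 mf f0.
have mf2 : measurable_fun setT (fun z : R2 => f ((c * z.1 + b1)%R, (c * z.2 + b2)%R)).
  apply: (measurableT_comp mf); apply/measurable_fun_pair => /=.
    exact: (measurableT_comp (measurable_affine c b1)).
  exact: (measurableT_comp (measurable_affine c b2)).
rewrite !ge0_integral_leb2//.
have mF := measurable_fun_fubini_tonelli_F (m2 := leb) f mf f0.
rewrite (ge0_integral_affine b1 c0 mF); last first.
  by move=> x; exact: integral_ge0.
rewrite expr2 EFinM -muleA; congr (_ * _)%E.
rewrite -ge0_integralZl//; last 3 first.
- exact: (measurable_fun_fubini_tonelli_F (m2 := leb) _ mf2).
- by move=> x _; exact: integral_ge0.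
- by rewrite lee_fin ltW.
apply: eq_integral => x _; rewrite /fubini_F/=.
rewrite (ge0_integral_affine (f := fun y => f ((c * x + b1)%R, y)) b2 c0)//.
exact: (measurableT_comp mf (pair1_measurable _)).
Qed.

Lemma ge0_integral_leb2_opp (f : R2 -> \bar R) :
  measurable_fun setT f -> (forall x, 0 <= f x)%E ->
  (\int[leb2]_z f z = \int[leb2]_z f ((- z.1)%R, (- z.2)%R))%E.
Proof.
move=> mf f0.
have mf2 : measurable_fun setT (fun z : R2 => f ((- z.1)%R, (- z.2)%R)).
  apply: (measurableT_comp mf); apply/measurable_fun_pair => /=;
  exact: measurableT_comp.
rewrite !ge0_integral_leb2//.
have mF := measurable_fun_fubini_tonelli_F (m2 := leb) f mf f0.
rewrite (ge0_integral_opp mF); last by move=> x; exact: integral_ge0.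
apply: eq_integral => x _; rewrite /fubini_F/=.
rewrite (ge0_integral_opp (f := fun y => f ((- x)%R, y)))//.
exact: (measurableT_comp mf (pair1_measurable _)).
Qed.

End plane.

(** * Measurability of inverses and an improper integral on a half-line *)

Section radial.
Variable R : realType.
Local Notation leb := (@lebesgue_measure R).
Local Notation leb2 := (sigma_finite_product leb leb).
Local Notation R2 := (measurableTypeR R * measurableTypeR R)%type.
Local Open Scope classical_set_scope.

(** Writes [f^-1] as [f * (f^2)^-1], since [powR] is identified with the inverse on nonnegative
    bases; at a zero of [f] both sides are 0. *)
Lemma measurable_funV d (T : measurableType d) (f : T -> R) :
  measurable_fun setT f -> measurable_fun setT (fun x => (f x)^-1).
Proof.
move=> mf.
rewrite (_ : (fun x => _) = (fun x => f x * ((@powR R)^~ (-1) \o (fun x => f x ^+ 2)) x)).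
  apply: measurable_funM => //; apply: measurableT_comp; first exact: measurable_powR.
  exact: measurable_funX.
apply/funext => x /=; rewrite powR_inv1 ?sqr_ge0//.
have [->|fx0] := eqVneq (f x) 0; first by rewrite invr0 mul0r.
by rewrite expr2 invfM mulrA divff// mul1r.
Qed.

(** Fundamental theorem of calculus for the antiderivative [- (t + r) ^- p.+1], which tends to 0 at
    infinity. *)
Lemma integral_shifted_invX (s r : R) (p : nat) : 0 < s -> 0 <= r ->
  (\int[leb]_(t in `[s, +oo[) (p.+1%:R * (t + r) ^- p.+2)%:E =
   ((s + r) ^- p.+1)%:E)%E.
Proof.
move=> s0 r0.
pose F t : R := - (t + r) ^- p.+1.
have dF (t : R) : 0 < t -> is_derive t 1 F (p.+1%:R * (t + r) ^- p.+2).
  move=> t0; have tr0 : t + r != 0 by rewrite gt_eqF// ltr_wpDr.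
  have h1 : is_derive t (1 : R) (fun t : R => t + r) 1.
    by apply: is_derive_eq; rewrite addr0.
  have h2 := is_deriveX p.+1 h1.
  have hn : ((fun t : R => t + r) ^+ p.+1) t != 0.
    by rewrite fctE expf_neq0.
  have h3 := is_deriveN (is_deriveV hn h2).
  rewrite (_ : F = - (fun y => (((fun t0 : R => t0 + r) ^+ p.+1) y)^-1)); last first.
    by apply/funext => u; rewrite /F fctE/= fctE.
  apply: is_derive_eq.
  rewrite fctE/= /GRing.scale/= mulr1 mulNr opprK.
  by rewrite !exprS; field; rewrite tr0 expf_neq0.
have cG (t : R) : 0 < t -> {for t, continuous (fun t : R => p.+1%:R * (t + r) ^- p.+2)}.
  move=> t0; apply: cvgM; first exact: cvg_cst.
  apply: cvgV; first by rewrite expf_neq0// gt_eqF// ltr_wpDr.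
  apply: (@continuous_comp _ _ _ (fun u : R => u + r) (fun u : R => u ^+ p.+2)).
    by apply: cvgD; [exact: cvg_id|exact: cvg_cst].
  exact: exprn_continuous.
rewrite (@ge0_continuous_FTC2y R _ F s 0).
- by rewrite /F sub0e EFinN oppeK.
- move=> t st; rewrite mulr_ge0// invr_ge0 exprn_ge0// addr_ge0//.
  by rewrite (le_trans _ st)// ltW.
- apply/continuous_within_itvcyP; split.
    move=> x; rewrite in_itv/= andbT => sx; apply: cG.
    exact: lt_trans sx.
  by apply: cvg_at_right_filter; exact: cG.
- rewrite -oppr0; apply: cvgN; apply/gtr0_cvgV0.
    near=> t; rewrite exprn_gt0// ltr_wpDr//; near: t; exact: nbhs_pinfty_gt.
  apply/cvgryPge => A; near=> t.
  have t1 : 1 <= t by near: t; exact: nbhs_pinfty_ge.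
  apply: (@le_trans _ _ (t + r)).
    by rewrite ler_wpDr//; near: t; exact: nbhs_pinfty_ge.
  by rewrite ler_eXnr// ler_wpDr.
- by move=> x sx; apply: ex_derive; apply: dF; exact: lt_trans sx.
- by apply: cvg_at_right_filter; apply: differentiable_continuous;
  apply/derivable1_diffP; apply: ex_derive; exact: dF.
- move=> x; rewrite in_itv/= andbT => sx; rewrite derive1E; apply: derive_val.
  exact: (dF _ (lt_trans s0 sx)).
Unshelve. all: by end_near. Qed.

End radial.

(** * The radial integrals over the plane *)

Section kappa.
Variable R : realType.
Local Notation leb := (@lebesgue_measure R).
Local Notation leb2 := (sigma_finite_product leb leb).
Local Notation R2 := (measurableTypeR R * measurableTypeR R)%type.
Local Open Scope classical_set_scope.

Definition rad (z : R2) : R := z.1 ^+ 2 + z.2 ^+ 2.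

Lemma rad_ge0 z : 0 <= rad z.
Proof. by rewrite addr_ge0// sqr_ge0. Qed.

Lemma measurable_rad : measurable_fun setT rad.
Proof. by apply: measurable_funD; apply: measurable_funX. Qed.

Lemma measurable_inv_radX (s : R) p :
  measurable_fun setT (fun z : R2 => (s + rad z) ^- p).
Proof.
apply: measurable_funV; apply: measurable_funX; apply: measurable_funD => //.
exact: measurable_rad.
Qed.

Lemma inv_radX_ge0 (s : R) p z : 0 <= s -> 0 <= (s + rad z) ^- p.
Proof. by move=> s0; rewrite invr_ge0 exprn_ge0// addr_ge0// rad_ge0. Qed.

Definition kappa p : \bar R := (\int[leb2]_z ((1 + rad z) ^- p)%:E)%E.

(** Scaling the plane by the square root of s has Jacobian s, which cancels one of the p + 1 powers
    of s. *)
Lemma integral_inv_radX (s : R) p : 0 < s ->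
  (\int[leb2]_z ((s + rad z) ^- p.+1)%:E = (s ^- p)%:E * kappa p.+1)%E.
Proof.
move=> s0.
rewrite (@ge0_integral_leb2_affine R (Num.sqrt s) 0 0) ?sqrtr_gt0//; last 2 first.
- by apply/measurable_EFinP; exact: measurable_inv_radX.
- by move=> z; rewrite lee_fin inv_radX_ge0// ltW.
rewrite sqr_sqrtr ?ltW//=.
rewrite /kappa -[RHS]ge0_integralZl//; last 3 first.
- by apply/measurable_EFinP; exact: measurable_inv_radX.
- by move=> z _; rewrite lee_fin inv_radX_ge0.
- by rewrite lee_fin invr_ge0 exprn_ge0// ltW.
rewrite -[LHS]ge0_integralZl//; last 3 first.
- apply/measurable_EFinP/measurable_funV.
  apply: measurable_funX; apply: measurable_funD => //.
  by apply: measurable_funD; apply: measurable_funX => //=; apply: measurable_funD => //;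
    apply: measurable_funM.
- by move=> z _; rewrite lee_fin inv_radX_ge0// ltW.
- by rewrite lee_fin ltW.
apply: eq_integral => z _; rewrite -!EFinM /rad/= !addr0 !exprMn sqr_sqrtr ?ltW//.
congr (_%:E); rewrite -{2}(mulr1 s) -!mulrDr exprMn exprS.
have : (1 + (z.1 ^+ 2 + z.2 ^+ 2)) != 0 by rewrite gt_eqF// ltr_pwDl// rad_ge0.
move: (_ + _) => y y0; rewrite !exprS; field.
by rewrite y0 !expf_neq0 // gt_eqF.
Qed.

(** Comes from [rad z = (s + rad z) - s], stated additively because the integrals may still be
    infinite. *)
Lemma integral_radM (s : R) p : 0 < s ->
  (\int[leb2]_z (rad z * (s + rad z) ^- p.+1)%:E
    + s%:E * \int[leb2]_z ((s + rad z) ^- p.+1)%:E =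
   \int[leb2]_z ((s + rad z) ^- p)%:E)%E.
Proof.
move=> s0; rewrite -ge0_integralZl//; last 3 first.
- by apply/measurable_EFinP; exact: measurable_inv_radX.
- by move=> z _; rewrite lee_fin inv_radX_ge0// ltW.
- by rewrite lee_fin ltW.
rewrite -ge0_integralD//; last 4 first.
- by move=> z _; rewrite lee_fin mulr_ge0 ?rad_ge0// inv_radX_ge0// ltW.
- apply/measurable_EFinP/measurable_funM; first exact: measurable_rad.
  exact: measurable_inv_radX.
- by move=> z _; rewrite -EFinM lee_fin mulr_ge0 ?inv_radX_ge0// ltW.
- by apply/measurable_EFinP/measurable_funM => //; exact: measurable_inv_radX.
apply: eq_integral => z _; rewrite -EFinM -EFinD -mulrDl addrC.
have y0 : s + rad z != 0 by rewrite gt_eqF// ltr_pwDl// rad_ge0.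
by congr (_%:E); rewrite exprS invfM mulrA divff// mul1r.
Qed.

(* (1 + r)^-p = p * int_1^oo (t + r)^-(p+1) dt, Tonelli, and the scaling law
   of integral_inv_radX. *)
Lemma kappa_recr k :
  (kappa k.+2 = (k.+2%:R / k.+1%:R)%:E * kappa k.+3)%E.
Proof.
pose D := `[1 : R, +oo[ : set (measurableTypeR R).
have mD : measurable D by exact: measurable_itv.
(* The absolute value changes nothing on [D] and keeps every factor nonnegative off [D], so that
   Tonelli applies on the whole product space. *)
pose g (w : R2 * measurableTypeR R) : R :=
  k.+2%:R * (`|w.2 : R| + rad w.1) ^- k.+3 * \1_D w.2.
have g0 w : (0 <= (g w)%:E)%E.
  by rewrite lee_fin !mulr_ge0 ?inv_radX_ge0// indicE.
have mg : measurable_fun setT (EFin \o g).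
  apply/measurable_EFinP; apply: measurable_funM; last first.
    by apply: measurableT_comp.
  apply: measurable_funM => //; apply: measurable_funV.
  apply: measurable_funX; apply: measurable_funD; first exact: measurableT_comp.
  by apply: measurableT_comp => //; exact: measurable_rad.
have gD z t : D t -> g (z, t) = k.+2%:R * (t + rad z) ^- k.+3.
  rewrite /D/= in_itv/= andbT => t1.
  rewrite /g/= indicE mem_set; last by rewrite /D/= in_itv/= t1.
  by rewrite mulr1 ger0_norm// (le_trans _ t1).
have gND z t : ~ D t -> g (z, t) = 0.
  by move=> Dt; rewrite /g indicE memNset// mulr0.
have := fubini_tonelli (m1 := leb2) (m2 := leb) (EFin \o g) mg g0.
rewrite (_ : (\int[_]_x _)%E = kappa k.+2); last first.
  apply: eq_integral => z _.
  rewrite -(@integral_shifted_invX R 1 (rad z) k.+1)// ?rad_ge0//.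
  rewrite [RHS]integral_mkcond; apply: eq_integral => t _ /=.
  rewrite patchE; case: ifPn => [|]; first by rewrite inE => /gD ->.
  by rewrite notin_setE => /gND ->.
move=> ->.
transitivity (\int[leb]_(t in D) ((k.+2%:R * (t + 0) ^- k.+2)%:E * kappa k.+3))%E.
  rewrite [RHS]integral_mkcond; apply: eq_integral => t _ /=.
  rewrite patchE; case: ifPn => [|]; last first.
    by rewrite notin_setE => Dt; under eq_integral do rewrite gND//; rewrite integral0.
  rewrite inE => Dt; under eq_integral do rewrite gD// EFinM.
  move: (Dt); rewrite /D/= in_itv/= andbT => t1.
  have t0 : 0 < t by rewrite (lt_le_trans _ t1).
  rewrite ge0_integralZl//; last 2 first.
  - by apply/measurable_EFinP; exact: measurable_inv_radX.
  - by move=> z _; rewrite lee_fin inv_radX_ge0// ltW.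
  by rewrite integral_inv_radX// muleA -EFinM addr0.
rewrite ge0_integralZr//; last 3 first.
- apply: measurable_funTS; apply/measurable_EFinP; apply: measurable_funM => //.
  by apply: measurable_funV; apply: measurable_funX; apply: measurable_funD.
- move=> t /=; rewrite /D/= in_itv/= andbT => t1.
  by rewrite lee_fin mulr_ge0// invr_ge0 exprn_ge0// addr0 (le_trans _ t1).
- by apply: integral_ge0 => z _; rewrite lee_fin inv_radX_ge0.
congr (_ * _)%E.
(* At s = 1 and r = 0 this says that (k + 1) t^-(k + 2) has integral 1 over [D], whence the ratio (k
   + 2) / (k + 1). *)
have := @integral_shifted_invX R 1 0 k ltr01 (lexx _).
rewrite addr0 expr1n invr1 => h.
rewrite -[RHS]mule1 -h -[RHS]ge0_integralZl//.
- by apply: eq_integral => t _; rewrite -EFinM mulrA divfK.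
- apply: measurable_funTS; apply/measurable_EFinP; apply: measurable_funM => //.
  by apply: measurable_funV; apply: measurable_funX; apply: measurable_funD.
- move=> t /=; rewrite in_itv/= andbT => t1.
  by rewrite lee_fin mulr_ge0// invr_ge0 exprn_ge0// addr0 (le_trans _ t1).
Qed.

(** On the unit square [rad] is at most 2, so the integrand is at least [3 ^- p] there. *)
Lemma kappa_gt0 p : (0 < kappa p)%E.
Proof.
pose A := `[0 : R, 1] : set (measurableTypeR R).
have mA : measurable A by exact: measurable_itv.
have mAA : measurable (A `*` A) by exact: measurableX.
apply: (@lt_le_trans _ _ (\int[leb2]_z ((3 ^- p)%:E * (\1_(A `*` A) z)%:E))%E).
  rewrite ge0_integralZl//; last exact/measurable_EFinP/measurable_indic.
  rewrite integral_indic// setIT.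
  have hA : leb A = 1%E by rewrite lebesgue_measure_itv/= lte_fin ltr01 oppr0 adde0.
  have hAA : sigma_finite_product leb leb (A `*` A) = 1%E.
    by transitivity (leb A * leb A)%E; [exact: product_measure1E|rewrite hA mule1].
  apply: (eq_ind_r (fun x => 0 < _ * x)%E _ hAA).
  by rewrite !mule1 lte_fin invr_gt0 exprn_gt0.
apply: ge0_le_integral => //.
- by apply/measurable_EFinP/measurable_funM => //; exact: measurable_indic.
- by apply/measurable_EFinP; exact: measurable_inv_radX.
move=> z _; rewrite -EFinM lee_fin indicE.
have r0 := rad_ge0 z.
have [|_] := boolP (z \in _); last by rewrite mulr0 inv_radX_ge0.
rewrite inE /A/= !in_itv/= => -[/andP[x0 x1] /andP[y0 y1]].
rewrite mulr1 lef_pV2 ?posrE ?exprn_gt0 ?ltr_pwDl//.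
rewrite lerXn2r ?nnegrE//; first by rewrite addr_ge0.
rewrite /rad; move: z.1 z.2 x0 x1 y0 y1 => x y; nra.
Qed.

(** As (1 + x^2) (1 + y^2) <= (1 + x^2 + y^2)^2, the integrand is dominated by a product of two
    derivatives of the arctangent. *)
Lemma kappa2_lty : (kappa 2 < +oo)%E.
Proof.
have c1 : continuous (fun x : R => (1 + x ^+ 2)^-1) := @continuous_oneDsqrV R.
have fin1 : (\int[leb]_x ((1 + x ^+ 2)^-1)%:E < +oo)%E.
  rewrite ge0_symfun_integralT//; last 2 first.
  - by move=> x; rewrite invr_ge0 addr_ge0// sqr_ge0.
  - by move=> x /=; rewrite sqrrN.
  rewrite -set_itvcy integral0y_oneDsqr.
  by rewrite -EFinM ltry.
have m1 : measurable_fun setT (fun x : measurableTypeR R => (1 + x ^+ 2)^-1).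
  by apply: measurable_funV; apply: measurable_funD => //; exact: measurable_funX.
have g1 (x : R) : (0 <= (1 + x ^+ 2)^-1).
  by rewrite invr_ge0 addr_ge0// sqr_ge0.
apply: (@le_lt_trans _ _ (\int[leb2]_z ((1 + z.1 ^+ 2)^-1 * (1 + z.2 ^+ 2)^-1)%:E)%E).
  apply: ge0_le_integral => //.
  - by move=> z _; rewrite lee_fin inv_radX_ge0.
  - by apply/measurable_EFinP; exact: measurable_inv_radX.
  - by apply/measurable_EFinP/measurable_funM;
    [exact: (measurableT_comp m1 measurable_fst)|exact: (measurableT_comp m1
      measurable_snd)].
  move=> z _; rewrite lee_fin -invfM lef_pV2 ?posrE ?mulr_gt0 ?exprn_gt0 ?ltr_pwDl
    ?rad_ge0 ?sqr_ge0//.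
  by rewrite /rad; move: (z.1 ^+ 2) (z.2 ^+ 2) (sqr_ge0 z.1) (sqr_ge0 z.2) => x y; nra.
rewrite ge0_integral_leb2; last 2 first.
- by apply/measurable_EFinP/measurable_funM;
  [exact: (measurableT_comp m1 measurable_fst)|exact: (measurableT_comp m1 measurable_snd)].
- by move=> z; rewrite lee_fin mulr_ge0.
under eq_integral.
  move=> x _; under eq_integral do rewrite /= EFinM.
  rewrite ge0_integralZl//=; last 3 first.
    exact/measurable_EFinP.
    by move=> y _; rewrite lee_fin.
    by rewrite lee_fin.
  over.
rewrite ge0_integralZr//=; last 3 first.
- exact/measurable_EFinP.
- by move=> x _; rewrite lee_fin.
- by apply: integral_ge0 => x _; rewrite lee_fin.
by rewrite lte_mul_pinfty// ?integral_ge0// ?ge0_fin_numE// ?integral_ge0//; move=> x _;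
  rewrite lee_fin.
Qed.

(** By [kappa_recr] an infinite value would propagate down to [kappa 2]. *)
Lemma kappa_fin_num k : kappa k.+2 \is a fin_num.
Proof.
rewrite ge0_fin_numE ?ltW ?kappa_gt0//; elim: k => [|k IH]; first exact: kappa2_lty.
rewrite ltey; apply/eqP => koo.
by move: IH; rewrite kappa_recr koo gt0_muley// lte_fin divr_gt0.
Qed.

End kappa.

(** * Measurability and iterated integration over complex coordinates *)

Section complex_measurability.
Variable R : realType.
Local Notation C := (complex R).
Local Open Scope classical_set_scope.

Lemma conjCE (z : C) : (z^*)%R = Complex (complex.Re z) (- complex.Im z).
Proof. by case: z. Qed.

Lemma ReD (x y : C) : complex.Re (x + y) = complex.Re x + complex.Re y.
Proof. by case: x y => [a b] [c d]. Qed.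
Lemma ImD (x y : C) : complex.Im (x + y) = complex.Im x + complex.Im y.
Proof. by case: x y => [a b] [c d]. Qed.
Lemma ReM (x y : C) : complex.Re (x * y) =
  complex.Re x * complex.Re y - complex.Im x * complex.Im y.
Proof. by case: x y => [a b] [c d]. Qed.
Lemma ImM (x y : C) : complex.Im (x * y) =
  complex.Re x * complex.Im y + complex.Im x * complex.Re y.
Proof. by case: x y => [a b] [c d]. Qed.

Section cmeas.
Context d (T : measurableType d).
Implicit Types f g : T -> C.

Definition cmeasurable f :=
  measurable_fun setT (fun x => complex.Re (f x)) /\
  measurable_fun setT (fun x => complex.Im (f x)).

Lemma cmeasurable_cst c : cmeasurable (fun=> c).
Proof. by split; exact: measurable_cst. Qed.

Lemma cmeasurableD f g : cmeasurable f -> cmeasurable g ->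
  cmeasurable (fun x => f x + g x).
Proof.
move=> [f1 f2] [g1 g2]; split.
- by under eq_fun do rewrite ReD; exact: measurable_funD.
- by under eq_fun do rewrite ImD; exact: measurable_funD.
Qed.

Lemma cmeasurableM f g : cmeasurable f -> cmeasurable g ->
  cmeasurable (fun x => f x * g x).
Proof.
move=> [f1 f2] [g1 g2]; split.
- by under eq_fun do rewrite ReM; apply: measurable_funB; exact: measurable_funM.
- by under eq_fun do rewrite ImM; apply: measurable_funD; exact: measurable_funM.
Qed.

Lemma cmeasurable_conj f : cmeasurable f -> cmeasurable (fun x => (f x)^*).
Proof.
move=> [f1 f2]; split; under eq_fun do rewrite conjCE/=; first by [].
exact: measurableT_comp.
Qed.

Lemma cmeasurable_sum I (r : seq I) (P : pred I) (F : I -> T -> C) :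
  (forall i, P i -> cmeasurable (F i)) ->
  cmeasurable (fun x => \sum_(i <- r | P i) F i x).
Proof.
move=> mF; elim: r => [|i r IH].
  by under eq_fun do rewrite big_nil; exact: cmeasurable_cst.
under eq_fun do rewrite big_cons; case: (boolP (P i)) => // Pi.
by apply: cmeasurableD => //; exact: mF.
Qed.

Lemma cmeasurable_prod I (r : seq I) (P : pred I) (F : I -> T -> C) :
  (forall i, P i -> cmeasurable (F i)) ->
  cmeasurable (fun x => \prod_(i <- r | P i) F i x).
Proof.
move=> mF; elim: r => [|i r IH].
  by under eq_fun do rewrite big_nil; exact: cmeasurable_cst.
under eq_fun do rewrite big_cons; case: (boolP (P i)) => // Pi.
by apply: cmeasurableM => //; exact: mF.
Qed.

Lemma cmeasurable_det n (F : T -> 'M[C]_n) :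
  (forall i j, cmeasurable (fun x => F x i j)) -> cmeasurable (fun x => \det (F x)).
Proof.
move=> mF; apply: cmeasurable_sum => s _; apply: cmeasurableM.
  exact: cmeasurable_cst.
by apply: cmeasurable_prod.
Qed.

End cmeas.
End complex_measurability.

Section power.
Variable R : realType.
Local Notation C := (complex R).
Local Notation leb := (@lebesgue_measure R).
Local Notation leb2 := (sigma_finite_product leb leb).
Local Notation lpow := (lebesgue_complex_power R).
Local Notation R2 := (measurableTypeR R * measurableTypeR R)%type.
Local Open Scope classical_set_scope.

Lemma measurable_cons_pair n :
  measurable_fun setT (fun p : R2 * n.-tuple R2 => [tuple of p.1 :: p.2]).
Proof. exact: measurable_cons_tup. Qed.

Lemma ge0_integral_cons n (f : n.+1.-tuple R2 -> \bar R) :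
  measurable_fun setT f -> (forall x, 0 <= f x)%E ->
  (\int[lpow n.+1]_x f x =
   \int[leb2]_h \int[lpow n]_t f [tuple of h :: t])%E.
Proof.
move=> mf f0.
rewrite [LHS](ge0_integral_pushforward (@measurable_cons_pair n)
  (sigma_finite_product leb2 (lpow n)))//.
rewrite preimage_setT [LHS](fubini_tonelli1 (m1 := leb2) (m2 := lpow n))//;
  last by move=> x; exact: f0.
by apply: measurableT_comp => //; exact: measurable_cons_pair.
Qed.

Lemma measurable_integral_cons n (f : n.+1.-tuple R2 -> \bar R) :
  measurable_fun setT f -> (forall x, 0 <= f x)%E ->
  measurable_fun setT (fun h => \int[lpow n]_t f [tuple of h :: t])%E.
Proof.
move=> mf f0.
have := @measurable_fun_fubini_tonelli_F _ _ _ _ R (lpow n)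
  (f \o (fun p : R2 * n.-tuple R2 => [tuple of p.1 :: p.2])).
apply; last by move=> x; exact: f0.
by apply: measurableT_comp => //; exact: measurable_cons_pair.
Qed.

Lemma measurable_cons_fix n (f : n.+1.-tuple R2 -> \bar R) h :
  measurable_fun setT f ->
  measurable_fun setT (fun t : n.-tuple R2 => f [tuple of h :: t]).
Proof.
move=> mf; apply: (measurableT_comp mf).
exact: (measurable_cons (measurable_cst h) (@measurable_id _ _ setT)).
Qed.

Lemma integral_lpow0 (f : 0.-tuple R2 -> \bar R) :
  (\int[lpow 0]_x f x = f [tuple])%E.
Proof.
rewrite integral_dirac//=; last first.
  move=> _ Y _; rewrite setTI.
  have [h|h] := pselect (Y (f [tuple])).
    rewrite (_ : _ @^-1` _ = setT)//; apply/seteqP; split=> // x _.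
    by rewrite /= (tuple0 x).
  rewrite (_ : _ @^-1` _ = set0)//; apply/seteqP; split=> // x /=.
  by rewrite (tuple0 x).
by rewrite diracT mul1e.
Qed.

Lemma measurable_cat_pair k m :
  measurable_fun setT (fun p : k.-tuple R2 * m.-tuple R2 => [tuple of p.1 ++ p.2]).
Proof.
apply/measurable_fun_tnthP => i.
case: (split_ordP i) => j ->.
  rewrite (_ : _ \o _ = (fun x => tnth x j) \o fst); last first.
    by apply/funext => p /=; rewrite tnth_lshift.
  exact: (measurableT_comp (measurable_tnth _) measurable_fst).
rewrite (_ : _ \o _ = (fun x => tnth x j) \o snd); last first.
  by apply/funext => p /=; rewrite tnth_rshift.
exact: (measurableT_comp (measurable_tnth _) measurable_snd).
Qed.

Lemma measurable_integral_cat k m (f : seq R2 -> \bar R) :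
  measurable_fun setT (fun x : (k + m).-tuple R2 => f x) ->
  (forall x, 0 <= f x)%E ->
  measurable_fun setT (fun x : k.-tuple R2 => \int[lpow m]_y f (x ++ y))%E.
Proof.
move=> mf f0.
have := @measurable_fun_fubini_tonelli_F _ _ _ _ R (lpow m)
  ((fun x : (k + m).-tuple R2 => f x) \o
   (fun p : k.-tuple R2 * m.-tuple R2 => [tuple of p.1 ++ p.2])).
apply; last by move=> x; exact: f0.
by apply: measurableT_comp => //; exact: measurable_cat_pair.
Qed.

(** The integrand takes sequences rather than tuples: [x ++ y] then needs no cast, although the
    lengths involved are equal only propositionally. *)
Lemma ge0_integral_cat k m (f : seq R2 -> \bar R) :
  measurable_fun setT (fun x : (k + m).-tuple R2 => f x) ->
  (forall x, 0 <= f x)%E ->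
  (\int[lpow (k + m)]_x f x =
   \int[lpow k]_x \int[lpow m]_y f (x ++ y))%E.
Proof.
elim: k f => [|k IH] f mf f0; first by rewrite integral_lpow0.
rewrite [LHS](@ge0_integral_cons (k + m) f)//.
rewrite ge0_integral_cons//; last 2 first.
- exact: measurable_integral_cat.
- by move=> x; exact: integral_ge0.
apply: eq_integral => h _.
rewrite (IH (fun s => f (h :: s)))//.
exact: (@measurable_cons_fix (k + m) f h).
Qed.

End power.

(** * Triangular affine substitutions *)

Section change_of_variables.
Variable R : realType.
Local Notation C := (complex R).
Local Notation leb := (@lebesgue_measure R).
Local Notation leb2 := (sigma_finite_product leb leb).
Local Notation lpow := (lebesgue_complex_power R).
Local Notation R2 := (measurableTypeR R * measurableTypeR R)%type.
Local Open Scope classical_set_scope.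

Definition pair_of_complex (z : C) : R2 := (complex.Re z, complex.Im z).

Lemma pair_of_complexK : cancel pair_of_complex (@complex_of_pair R).
Proof. by case. Qed.

Definition tvec m (t : m.-tuple R2) : 'cV[C]_m :=
  \col_i complex_of_pair (tnth t i).

Definition affine_tuple m (L : 'M[C]_m) (b : 'cV[C]_m) (t : m.-tuple R2) :
  m.-tuple R2 := [tuple pair_of_complex ((L *m tvec t + b) i 0) | i < m].

Lemma tvec_affine m (L : 'M[C]_m) b t :
  tvec (affine_tuple L b t) = L *m tvec t + b.
Proof.
by apply/matrixP => i j; rewrite ord1 mxE tnth_mktuple pair_of_complexK.
Qed.

Lemma cmeasurable_tvec m i j : cmeasurable (fun t : m.-tuple R2 => tvec t i j).
Proof.
split; under eq_fun do rewrite mxE/=.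
  exact: (measurableT_comp measurable_fst (measurable_tnth _)).
exact: (measurableT_comp measurable_snd (measurable_tnth _)).
Qed.

Lemma cmeasurable_mul_tvec m n (A : 'M[C]_(n, m)) i j :
  cmeasurable (fun t : m.-tuple R2 => (A *m tvec t) i j).
Proof.
under eq_fun do rewrite mxE; apply: cmeasurable_sum => l _.
by apply: cmeasurableM; [exact: cmeasurable_cst|exact: cmeasurable_tvec].
Qed.

Lemma measurable_affine_tuple m (L : 'M[C]_m) b :
  measurable_fun setT (affine_tuple L b).
Proof.
apply/measurable_fun_tnthP => i.
rewrite (_ : _ \o _ = (fun t => pair_of_complex ((L *m tvec t + b) i 0))); last first.
  by apply/funext => t /=; rewrite tnth_mktuple.
have [m1 m2] : cmeasurable (fun t : m.-tuple R2 => (L *m tvec t + b) i 0).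
  under eq_fun do rewrite mxE; apply: cmeasurableD; last exact: cmeasurable_cst.
  exact: cmeasurable_mul_tvec.
exact: measurable_fun_pair.
Qed.

Lemma tvec_cons m h (t : m.-tuple R2) :
  tvec [tuple of h :: t] = col_mx (complex_of_pair h)%:M (tvec t) :> 'cV[C]_(1 + m).
Proof.
apply/matrixP => i j; rewrite ord1.
case: (@fintype.split_ordP 1 m i) => l ->.
  by rewrite col_mxEu !mxE !ord1 eqxx mulr1n.
by rewrite col_mxEd !mxE rshift1 tnthS.
Qed.

Lemma affine_tuple_cons m (L : 'M[C]_(1 + m)) b h (t : m.-tuple R2) :
  ursubmx L = 0 ->
  affine_tuple L b [tuple of h :: t] =
  [tuple of pair_of_complex (L 0 0 * complex_of_pair h + b 0 0) ::
     affine_tuple (drsubmx L)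
       (dsubmx b + complex_of_pair h *: dlsubmx L) t].
Proof.
move=> L0.
have E : L *m tvec [tuple of h :: t] + b =
    col_mx (L 0 0 * complex_of_pair h + b 0 0)%:M
      (drsubmx L *m tvec t + (dsubmx b + complex_of_pair h *: dlsubmx L)).
  rewrite tvec_cons -{1}(submxK L) -{1}(vsubmxK b) mul_block_col L0 mul0mx addr0.
  rewrite add_col_mx; congr col_mx.
    apply/matrixP => i j; rewrite !ord1 !mxE big_ord1 !mxE !ord1 eqxx !mulr1n.
    by congr (L _ _ * _ + b _ _); exact: val_inj.
  by rewrite mul_mx_scalar -addrA addrC -addrA.
apply: eq_from_tnth => i; rewrite tnth_mktuple E.
case: (unliftP ord0 i) => [j|] -> /=.
  by rewrite tnthS tnth_mktuple (_ : lift ord0 j = rshift 1 j) ?col_mxEd//; exact: val_inj.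
transitivity (pair_of_complex (L 0 0 * complex_of_pair h + b 0 0)); last by [].
have cu (A : 'M[C]_1) (B : 'cV[C]_m) : col_mx A B (ord0 : 'I_(1 + m)) 0 = A 0 0.
  by rewrite -(col_mxEu A B); congr (col_mx _ _ _ _); exact: val_inj.
by rewrite cu mxE eqxx mulr1n.
Qed.

(* Back substitution: the i-th coordinate is an affine function of the i-th
   variable with coefficient L i i, once the previous variables are fixed. *)
Lemma ge0_integral_affine_tuple m (L : 'M[C]_m) (dg : 'I_m -> R) b
    (g : m.-tuple R2 -> \bar R) :
  (forall i j : 'I_m, (i < j)%N -> L i j = 0) ->
  (forall i, 0 < dg i) -> (forall i, L i i = Complex (dg i) 0) ->
  measurable_fun setT g -> (forall x, 0 <= g x)%E ->
  (\int[lpow m]_x g x =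
   (\prod_i dg i ^+ 2)%:E * \int[lpow m]_x g (affine_tuple L b x))%E.
Proof.
elim: m L dg b g => [|m IH] L dg b g Ltrig dg0 Ldg mg g0.
  rewrite !integral_lpow0 big_ord0 mul1e; congr g.
  by rewrite (tuple0 (affine_tuple _ _ _)).
have L0 : ursubmx (L : 'M[C]_(1 + m)) = 0.
  by apply/matrixP => i j; rewrite !mxE Ltrig//= !ord1.
have mga : measurable_fun setT (g \o affine_tuple L b).
  by apply: measurableT_comp => //; exact: measurable_affine_tuple.
rewrite [LHS]ge0_integral_cons//.
rewrite (@ge0_integral_leb2_affine R (dg 0) (complex.Re (b 0 0)) (complex.Im (b 0 0)))//;
  last 2 first.
- exact: measurable_integral_cons.
- by move=> x; exact: integral_ge0.
rewrite [in RHS](ge0_integral_cons mga); last by move=> x; exact: g0.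
rewrite [in RHS]big_ord_recl [in RHS]EFinM -[in RHS]muleA; congr (_ * _)%E.
rewrite -[RHS]ge0_integralZl//; last 3 first.
- exact: (measurable_integral_cons mga (fun x => g0 _)).
- by move=> x _; apply: integral_ge0 => y _; exact: g0.
- by rewrite lee_fin prodr_ge0// => i _; rewrite sqr_ge0.
apply: eq_integral => h _.
rewrite (IH (drsubmx (L : 'M[C]_(1 + m))) (fun i => dg (lift ord0 i))
  (dsubmx (b : 'cV[C]_(1 + m)) + complex_of_pair h *: dlsubmx (L : 'M[C]_(1 + m))))//;
    last 3 first.
- by move=> i j ij; rewrite !mxE !rshift1 Ltrig.
- by move=> i; rewrite !mxE !rshift1 Ldg.
- exact: measurable_cons_fix.
congr (_ * _)%E; apply: eq_integral => t _.
rewrite /= affine_tuple_cons//; congr (g [tuple of _ :: _]).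
rewrite Ldg /pair_of_complex ReD ImD ReM ImM/= !mul0r subr0 addr0.
by congr (_, _).
Qed.

End change_of_variables.

(** * Nonnegative Hermitian forms integrated against spherical weights *)

Section quadratic_forms.
Variable R : realType.
Local Notation C := (complex R).

Definition nsq (z : C) : R := complex.Re z ^+ 2 + complex.Im z ^+ 2.

Lemma nsq_ge0 z : 0 <= nsq z.
Proof. by rewrite addr_ge0// sqr_ge0. Qed.

Definition hform (al be : R) (ga x y : C) : R :=
  al * nsq x + be * nsq y + 2 * complex.Re (ga * x * y^*).

Definition hform_ge0 al be ga := forall x y, 0 <= hform al be ga x y.

(** Averaging over a sign change of the linear part [(x, y)] kills its cross terms with the constant
    part [(x', y')]. *)
Lemma hform_parallelogram al be ga x y x' y' :
  hform al be ga (x + x') (y + y') + hform al be ga (- x + x') (- y + y') =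
  2 * hform al be ga x y + 2 * hform al be ga x' y'.
Proof.
rewrite /hform !conjCE /nsq.
case: ga x y x' y' => [? ?] [? ?] [? ?] [? ?] [? ?] /=; ring.
Qed.

Lemma hform_homog al be ga c x y :
  hform al be ga (x * c) (y * c) = nsq c * hform al be ga x y.
Proof.
rewrite /hform !conjCE /nsq.
case: ga x y c => [? ?] [? ?] [? ?] [? ?] /=; ring.
Qed.

End quadratic_forms.

Section spherical_integral.
Variable R : realType.
Local Notation C := (complex R).
Local Notation leb := (@lebesgue_measure R).
Local Notation leb2 := (sigma_finite_product leb leb).
Local Notation lpow := (lebesgue_complex_power R).
Local Notation R2 := (measurableTypeR R * measurableTypeR R)%type.
Local Open Scope classical_set_scope.

Variables (al be : R) (ga : C).
Hypothesis q0 : hform_ge0 al be ga.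
Local Notation q := (hform al be ga).

Lemma measurable_nsq d (T : measurableType d) (f : T -> C) :
  cmeasurable f -> measurable_fun setT (fun t => nsq (f t)).
Proof. by move=> [f1 f2]; apply: measurable_funD; exact: measurable_funX. Qed.

Lemma measurable_hform d (T : measurableType d) (f g : T -> C) :
  cmeasurable f -> cmeasurable g -> measurable_fun setT (fun t => q (f t) (g t)).
Proof.
move=> mf mg; apply: measurable_funD.
  by apply: measurable_funD; apply: measurable_funM => //; exact: measurable_nsq.
apply: measurable_funM => //.
have [] // : cmeasurable (fun t => ga * f t * (g t)^*).
by apply: cmeasurableM; [apply: cmeasurableM => //;
  exact: cmeasurable_cst|exact: cmeasurable_conj].
Qed.

Lemma cmeasurable_complex_of_pair : cmeasurable (@complex_of_pair R).
Proof. by split; [exact: measurable_fst|exact: measurable_snd]. Qed.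

Lemma cmeasurable_affine_pair c b :
  cmeasurable (fun h => c * complex_of_pair h + b : C).
Proof.
apply: cmeasurableD; last exact: cmeasurable_cst.
by apply: cmeasurableM; [exact: cmeasurable_cst|exact: cmeasurable_complex_of_pair].
Qed.

Lemma integral_radM_val (a : R) k : 0 < a ->
  (\int[leb2]_z (rad z * (a + rad z) ^- k.+3)%:E =
   (a ^- k.+1 * (fine (kappa R k.+3) / k.+1%:R))%:E)%E.
Proof.
move=> a0; have := integral_radM k.+2 a0.
rewrite !integral_inv_radX// (kappa_recr R k).
rewrite -[kappa R k.+3]fineK ?kappa_fin_num//; set K := fine _.
(* The right-hand side is finite, so the unknown integral is finite too and the other term may be
   subtracted. *)
case: (integral _ _ _) => [M||] //=; rewrite -!EFinM -EFinD => -[E].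
congr (_%:E); rewrite -[LHS](addrK (a * (a ^- k.+2 * K))) E.
rewrite !exprS; field.
by rewrite nat1r pnatr_eq0 expf_neq0 lt0r_neq0.
Qed.

(** The weight is even, so the integrand may be averaged over [h] and [- h]. By the parallelogram
    law only the quadratic part, homogeneous in [h], and the constant part survive. *)
Lemma ge0_integral_hform_radial (c d b b' : C) (w : R2 -> R) :
  measurable_fun setT w -> (forall z, 0 <= w z) ->
  (forall z, w (- z.1, - z.2) = w z) ->
  (\int[leb2]_h (q (c * complex_of_pair h + b) (d * complex_of_pair h + b') * w h)%:E =
   (q c d)%:E * \int[leb2]_h (rad h * w h)%:E + (q b b')%:E * \int[leb2]_h (w h)%:E)%E.
Proof.
move=> mw w0 weven.
pose f h : R := q (c * complex_of_pair h + b) (d * complex_of_pair h + b') * w h.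
have f0 h : 0 <= f h by rewrite mulr_ge0.
have mf : measurable_fun setT f.
  apply: measurable_funM => //; apply: measurable_hform; exact: cmeasurable_affine_pair.
pose fn (h : R2) : R := f (- h.1, - h.2).
have fn0 h : 0 <= fn h by exact: f0.
have mfn : measurable_fun setT fn.
  apply: (measurableT_comp mf); apply/measurable_fun_pair => /=;
  exact: measurableT_comp.
have E : (\int[leb2]_h (f h)%:E = \int[leb2]_h (2^-1 * f h + 2^-1 * fn h)%:E)%E.
  under [RHS]eq_integral do rewrite EFinD.
  rewrite ge0_integralD//; last 4 first.
  - by move=> h _; rewrite lee_fin mulr_ge0.
  - by apply/measurable_EFinP; exact: measurable_funM.
  - by move=> h _; rewrite lee_fin mulr_ge0.
  - by apply/measurable_EFinP; exact: measurable_funM.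
  under eq_integral do rewrite EFinM.
  under [X in (_ + X)%E]eq_integral do rewrite EFinM.
  rewrite !ge0_integralZl//; last 4 first.
  - by apply/measurable_EFinP.
  - by move=> h _; rewrite lee_fin.
  - by apply/measurable_EFinP.
  - by move=> h _; rewrite lee_fin.
  rewrite -(@ge0_integral_leb2_opp R (EFin \o f))//; last first.
  - exact/measurable_EFinP.
  rewrite -ge0_muleDl ?lee_fin//.
  by rewrite -EFinD (_ : 2^-1 + 2^-1 = 1) ?mul1e//; field.
rewrite [LHS]E.
under eq_integral.
  move=> h _; rewrite (_ : 2^-1 * _ + _ = q c d * (rad h * w h) + q b b' * w h); last first.
    rewrite /fn /f weven !mulrA -mulrDl -!mulrDr.
    rewrite (_ : complex_of_pair (- h.1, - h.2) = - complex_of_pair h)//.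
    rewrite !mulrN hform_parallelogram hform_homog /nsq /rad/=.
    by field.
  rewrite EFinD; over.
rewrite ge0_integralD//; last 4 first.
- by move=> h _; rewrite lee_fin !mulr_ge0// rad_ge0.
- by apply/measurable_EFinP; apply: measurable_funM => //; apply: measurable_funM => //;
  exact: measurable_rad.
- by move=> h _; rewrite lee_fin !mulr_ge0.
- by apply/measurable_EFinP; apply: measurable_funM.
under eq_integral do rewrite EFinM.
under [X in (_ + X)%E]eq_integral do rewrite EFinM.
rewrite !ge0_integralZl ?lee_fin//.
- by apply/measurable_EFinP.
- by move=> h _; rewrite lee_fin.
- by apply/measurable_EFinP; apply: measurable_funM => //; exact: measurable_rad.
- by move=> h _; rewrite lee_fin mulr_ge0// rad_ge0.
Qed.

Definition radn m (t : m.-tuple R2) : R := \sum_i rad (tnth t i).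

Lemma radn_ge0 m (t : m.-tuple R2) : 0 <= radn t.
Proof. by apply: sumr_ge0 => i _; exact: rad_ge0. Qed.

Lemma measurable_radn m : measurable_fun setT (@radn m).
Proof.
apply: measurable_sum => i.
exact: (measurableT_comp (@measurable_rad R) (measurable_tnth _)).
Qed.

(** The mass of (1 + |t|^2)^-(m + k + 2) over C^m, kept as a product of plane integrals. *)
Fixpoint sphere_const (m k : nat) : R :=
  if m is m'.+1 then sphere_const m' k.+1 * fine (kappa R k.+3) else 1.

Lemma sphere_const_gt0 m k : 0 < sphere_const m k.
Proof.
elim: m k => //= m IH k; rewrite mulr_gt0//.
by rewrite fine_gt0// kappa_gt0/= -ge0_fin_numE ?kappa_fin_num// ltW// kappa_gt0.
Qed.

Lemma mul_tvec_cons m (c : 'rV[C]_(1 + m)) h (t : m.-tuple R2) :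
  (c *m tvec [tuple of h :: t]) 0 0 =
  lsubmx c 0 0 * complex_of_pair h + (rsubmx c *m tvec t) 0 0.
Proof.
by rewrite tvec_cons -{1}(hsubmxK c) mul_row_col mul_mx_scalar mxE [in LHS]mxE mulrC.
Qed.

(** Under this weight the coordinates are centred and uncorrelated with second moment a / (k + 1),
    which is stated weakly, on forms of affine functions. Integrating m coordinates lowers the
    exponent by m. *)
Lemma ge0_integral_hform_spherical m k (c d : 'rV[C]_m) b b' (a : R) : 0 < a ->
  (\int[lpow m]_t (q ((c *m tvec t) 0 0 + b) ((d *m tvec t) 0 0 + b')
     * (a + radn t) ^- (m + k.+2))%:E =
  (sphere_const m k * a ^- k.+2 *
    (a / k.+1%:R * (\sum_i q (c 0 i) (d 0 i)) + q b b'))%:E)%E.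
Proof.
elim: m k c d b b' a => [|m IH] k c d b b' a a0.
  rewrite integral_lpow0 /radn !big_ord0 mulr0 add0r addr0 mul1r.
  by rewrite !mxE !big_ord0 !add0r mulrC.
rewrite ge0_integral_cons; last 2 first.
- apply/measurable_EFinP/measurable_funM; last first.
    by apply: measurable_funV; apply: measurable_funX; apply: measurable_funD => //;
      exact: measurable_radn.
  by apply: measurable_hform; apply: cmeasurableD;
    do ?[exact: cmeasurable_cst|exact: cmeasurable_mul_tvec].
- move=> t; rewrite lee_fin mulr_ge0// invr_ge0 exprn_ge0// addr_ge0// ?radn_ge0//.
  exact: ltW.
pose S := \sum_i q (rsubmx (c : 'rV_(1 + m)) 0 i) (rsubmx (d : 'rV_(1 + m)) 0 i).
have S0 : 0 <= S by exact: sumr_ge0.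
pose c0 := c 0 0; pose d0 := d 0 0.
(* The tail is integrated with [a + rad h] for [a] and [k.+1] for [k], the head [h] being absorbed
   in the constant parts. Its second moment [(a + rad h) / k.+2%:R] lowers the exponent of the first
   summand from k + 3 to k + 2. *)
transitivity (\int[leb2]_h ((sphere_const m k.+1)%:E *
   ((S / k.+2%:R * (a + rad h) ^- k.+2)%:E +
    (q (c0 * complex_of_pair h + b) (d0 * complex_of_pair h + b') * (a + rad h) ^-
      k.+3)%:E)))%E.
  apply: eq_integral => h _.
  have s0 : 0 < a + rad h by rewrite ltr_pwDl// rad_ge0.
  under eq_integral => t _.
    rewrite !mul_tvec_cons /radn big_ord_recl.
    under eq_bigr do rewrite tnthS.
    rewrite tnth0 addrA addSnnS -[lsubmx _ _ _ * _ + _ + b]addrA -[lsubmx _ _ _ * _ + _ +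
      b']addrA.
    rewrite ![lsubmx _ _ _ * _ + (_ + _)]addrCA.
    over.
  have := IH k.+1 (rsubmx (c : 'rV[C]_(1 + m))) (rsubmx (d : 'rV[C]_(1 + m)))
    (c0 * complex_of_pair h + b) (d0 * complex_of_pair h + b') _ s0.
  rewrite (_ : lsubmx _ 0 0 = c0); last by rewrite mxE; congr (c _ _); exact: val_inj.
  rewrite (_ : lsubmx _ 0 0 = d0); last by rewrite mxE; congr (d _ _); exact: val_inj.
  move=> ->; rewrite -EFinD -EFinM; congr (_%:E); rewrite -/S.
  rewrite !exprS; field.
  have sn0 := lt0r_neq0 s0.
  by rewrite expf_neq0// sn0 -natrD pnatr_eq0.
have mw : measurable_fun setT (fun h : R2 => (a + rad h) ^- k.+3).
  exact: measurable_inv_radX.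
have mq : measurable_fun setT (fun h : R2 =>
    q (c0 * complex_of_pair h + b) (d0 * complex_of_pair h + b') * (a + rad h) ^- k.+3).
  apply: measurable_funM => //; apply: measurable_hform; exact: cmeasurable_affine_pair.
have m1 : measurable_fun setT (fun h : R2 => S / k.+2%:R * (a + rad h) ^- k.+2).
  by apply: measurable_funM => //; exact: measurable_inv_radX.
rewrite ge0_integralZl//; last 3 first.
- by under eq_fun do rewrite -EFinD; apply/measurable_EFinP/measurable_funD.
- move=> h _; rewrite -EFinD lee_fin addr_ge0//.
    by rewrite mulr_ge0 ?divr_ge0// inv_radX_ge0// ltW.
  by rewrite mulr_ge0 ?inv_radX_ge0// ltW.
- by rewrite lee_fin ltW// sphere_const_gt0.
rewrite ge0_integralD//; last 4 first.
- by move=> h _; rewrite lee_fin mulr_ge0 ?divr_ge0// inv_radX_ge0// ltW.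
- exact/measurable_EFinP.
- by move=> h _; rewrite lee_fin mulr_ge0 ?inv_radX_ge0// ltW.
- exact/measurable_EFinP.
rewrite (ge0_integral_hform_radial c0 d0 b b' mw); last 2 first.
- by move=> h; rewrite inv_radX_ge0// ltW.
- by move=> h; rewrite /rad/= !sqrrN.
under eq_integral do rewrite EFinM.
rewrite ge0_integralZl//; last 3 first.
- by apply/measurable_EFinP; exact: measurable_inv_radX.
- by move=> h _; rewrite lee_fin inv_radX_ge0// ltW.
- by rewrite lee_fin divr_ge0.
rewrite integral_radM_val// !integral_inv_radX// (kappa_recr R k).
rewrite -[kappa R k.+3]fineK ?kappa_fin_num// -!(EFinM, EFinD).
rewrite (_ : \sum_(i < m.+1) _ = S + q c0 d0); last first.
  rewrite big_ord_recl addrC; congr (_ + _); apply: eq_bigr => i _.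
  by rewrite !mxE; congr (q (c _ _) (d _ _)); exact: val_inj.
congr (_%:E) => /=; rewrite !exprS; field.
have an0 := lt0r_neq0 a0.
by rewrite nat1r -natrD !pnatr_eq0 expf_neq0// an0.
Qed.

End spherical_integral.

(** * Cholesky factorization *)

Section cholesky.
Variable R : realType.
Local Notation C := (complex R).

Lemma adjmx_mul m n p (A : 'M[C]_(m, n)) (B : 'M[C]_(n, p)) :
  (A *m B) ^t* = B ^t* *m A ^t*.
Proof. by rewrite trmx_mul map_mxM. Qed.

Lemma adjmxD m n (A B : 'M[C]_(m, n)) : (A + B) ^t* = A ^t* + B ^t*.
Proof. by rewrite linearD map_mxD. Qed.

Lemma adjmxK m n (A : 'M[C]_(m, n)) : (A ^t*) ^t* = A.
Proof. by apply/matrixP => i j; rewrite !mxE conjCK. Qed.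

Lemma adj1mx n : (1%:M : 'M[C]_n) ^t* = 1%:M.
Proof. by rewrite trmx1 map_mx1. Qed.

Lemma adj_block m1 m2 n1 n2 (A : 'M[C]_(m1, n1)) (B : 'M[C]_(m1, n2))
    (D : 'M[C]_(m2, n1)) (E : 'M[C]_(m2, n2)) :
  (block_mx A B D E) ^t* = block_mx (A ^t*) (D ^t*) (B ^t*) (E ^t*).
Proof. by rewrite tr_block_mx map_block_mx. Qed.

Lemma real_complexE (z : C) : 0 <= z -> z = Complex (complex.Re z) 0.
Proof. by case: z => a b; rewrite lecE/= => /andP[/eqP-> _]. Qed.

Lemma mul_conjC_nsq (z : C) : z * z^* = Complex (nsq z) 0.
Proof.
by case: z => a b; rewrite conjCE /nsq/=; congr Complex => /=; ring.
Qed.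

Lemma nsq_normE (z : C) : `|z| ^+ 2 = Complex (nsq z) 0.
Proof. by rewrite normCK mul_conjC_nsq. Qed.

Definition posdef n (H : 'M[C]_n) := H ^t* = H /\
  forall v : 'rV[C]_n, v != 0 -> 0 < (v *m H *m v ^t*) 0 0.

(** Induction through the Schur complement of the leading entry. The positive real diagonal is the
    input that [ge0_integral_affine_tuple] expects. *)
Lemma posdef_cholesky n (H : 'M[C]_n) : posdef H ->
  exists (L : 'M[C]_n) (dg : 'I_n -> R),
  [/\ forall i j : 'I_n, (i < j)%N -> L i j = 0,
      forall i, 0 < dg i, forall i, L i i = Complex (dg i) 0 & H = L *m L ^t*].
Proof.
elim: n H => [|n IH] H [Hh Hp].
  exists 0, (fun=> 1); split=> //; try by case.
  by apply/matrixP; case.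
pose K : 'M[C]_(1 + n) := H.
have Kp (v : 'rV[C]_(1 + n)) : v != 0 -> 0 < (v *m K *m v ^t*) 0 0 := Hp v.
have Kh : K ^t* = K := Hh.
pose h := K 0 0; pose l := dlsubmx K; pose K' := drsubmx K.
have KE : K = block_mx h%:M (l ^t*) l K'.
  rewrite -[LHS]submxK; congr block_mx.
    by apply/matrixP => i j; rewrite !ord1 !mxE eqxx mulr1n; congr (K _ _); exact: val_inj.
  by rewrite -{1}Kh /l; apply/matrixP => i j; rewrite !mxE.
have hgt0 : 0 < h.
  have := Kp (row_mx 1%:M 0 : 'rV[C]_(1 + n)).
  rewrite KE mul_row_block !mul0mx !mul1mx !addr0 tr_row_mx map_col_mx.
  rewrite mul_row_col adj1mx mulmx1 trmx0 map_mx0 mulmx0 addr0 !mxE eqxx mulr1n.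
  apply; apply/eqP => /matrixP/(_ 0 (lshift n 0)).
  by rewrite row_mxEl !mxE eqxx => /eqP; rewrite oner_eq0.
have [r r0 hE] : exists2 r : R, 0 < r & h = Complex r 0.
  exists (complex.Re h); last exact: real_complexE (ltW hgt0).
  by move: hgt0; rewrite ltcE/= => /andP[].
have h0 : h != 0 by rewrite gt_eqF.
have hc : h^* = h by rewrite hE conjCE/= oppr0.
have K'h : K' ^t* = K'.
  by rewrite /K' -{2}Kh; apply/matrixP => i j; rewrite !mxE.
pose S := K' - h^-1 *: (l *m l ^t*).
have [|L' [dg' [L'trig dg'0 L'dg SE]]] := IH S.
  split.
    rewrite /S linearB/= map_mxB K'h linearZ/= map_mxZ adjmx_mul adjmxK.
    by rewrite fmorphV/= hc.
  (* The first coordinate is chosen so that the first block of the product with [K] vanishes; the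
     form of [K] at this vector is then the form of [S] at [v]. *)
  move=> v v0; have := Kp (row_mx (- (h^-1 *: (v *m l))) v : 'rV[C]_(1 + n)).
  rewrite KE mul_row_block tr_row_mx map_col_mx mul_row_col.
  rewrite mulNmx mul_mx_scalar scalerA divff// scale1r addNr mul0mx add0r.
  rewrite (_ : - (h^-1 *: (v *m l)) *m l ^t* + v *m K' = v *m S); last first.
    by rewrite mulmxBr mulNmx addrC -scalemxAl -scalemxAr mulmxA.
  apply; apply/eqP => E; move: v0; rewrite -(row_mxKr (- (h^-1 *: (v *m l))) v) E.
  by rewrite linear0 eqxx.
pose s : C := Complex (Num.sqrt r) 0.
have sc : s^* = s by rewrite conjCE/= oppr0.
have s2 : s * s = h.
  rewrite hE /s; simpc; rewrite -expr2 sqr_sqrtr//; exact: ltW.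
have s0 : s != 0 by apply: contraNneq h0 => s0; rewrite -s2 s0 mul0r.
pose M : 'M[C]_(1 + n) := block_mx s%:M 0 (s^-1 *: l) L'.
have MM : K = M *m M ^t*.
  rewrite KE /M adj_block mulmx_block trmx0 map_mx0 !mul0mx !mulmx0 !addr0.
  have ss : (s%:M : 'M[C]_1) ^t* = s%:M by rewrite tr_scalar_mx map_scalar_mx/= sc.
  have sl : (s^-1 *: l) ^t* = s^-1 *: l ^t*.
    by rewrite linearZ/= map_mxZ fmorphV/= sc.
  rewrite ss sl -scalar_mxM s2 mul_scalar_mx scalerA divff// scale1r.
  rewrite mul_mx_scalar scalerA divff// scale1r -SE.
  congr block_mx.
  by rewrite -scalemxAl -scalemxAr scalerA -invfM s2 /S addrC subrK.
have MSS i j : M (lift ord0 i) (lift ord0 j) = L' i j.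
  rewrite -[RHS](block_mxEdr (s%:M : 'M[C]_1) 0 (s^-1 *: l) L').
  by congr (M _ _); exact: val_inj.
have M0S j : M ord0 (lift ord0 j) = 0.
  transitivity ((0 : 'rV[C]_n) 0 j); last by rewrite mxE.
  rewrite -(block_mxEur (s%:M : 'M[C]_1) 0 (s^-1 *: l) L').
  by congr (M _ _); exact: val_inj.
have M00 : M ord0 ord0 = s.
  transitivity ((s%:M : 'M[C]_1) 0 0); last by rewrite mxE eqxx.
  rewrite -(block_mxEul (s%:M : 'M[C]_1) 0 (s^-1 *: l) L').
  by congr (M _ _); exact: val_inj.
exists M, (fun i => if unlift ord0 i is Some j then dg' j else Num.sqrt r).
split.
- move=> i j; case: (unliftP ord0 i) => [i'|] ->; case: (unliftP ord0 j) => [j'|] -> // ij.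
    by rewrite -[RHS](L'trig i' j')//; exact: MSS.
- by move=> i; case: (unliftP ord0 i) => [i'|] _ //; rewrite sqrtr_gt0.
- move=> i; case: (unliftP ord0 i) => [i'|] ->.
    by rewrite -[RHS]L'dg; exact: MSS.
  exact: M00.
exact: MM.
Qed.

End cholesky.

(** * Integrating out the last column *)

Section real_integrands.
Context d (T : measurableType d) (R : realType) (mu : {measure set T -> \bar R}).

Lemma ge0_integral_EFinZ (c : R) (f : T -> R) : 0 <= c ->
  measurable_fun setT f -> (forall x, 0 <= f x) ->
  (\int[mu]_x (c * f x)%:E = c%:E * \int[mu]_x (f x)%:E)%E.
Proof.
move=> c0 mf f0; under eq_integral do rewrite EFinM.
apply: ge0_integralZl => //; first exact/measurable_EFinP.
by move=> x _; rewrite lee_fin.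
Qed.

Lemma ge0_integral_EFinD (f g : T -> R) :
  measurable_fun setT f -> (forall x, 0 <= f x) ->
  measurable_fun setT g -> (forall x, 0 <= g x) ->
  (\int[mu]_x (f x + g x)%:E = \int[mu]_x (f x)%:E + \int[mu]_x (g x)%:E)%E.
Proof.
move=> mf f0 mg g0; under eq_integral do rewrite EFinD.
by apply: ge0_integralD => //; (try exact/measurable_EFinP) => x _; rewrite lee_fin.
Qed.

End real_integrands.

Section column_step.
Variable R : realType.
Local Notation C := (complex R).
Local Notation leb := (@lebesgue_measure R).
Local Notation leb2 := (sigma_finite_product leb leb).
Local Notation lpow := (lebesgue_complex_power R).
Local Notation R2 := (measurableTypeR R * measurableTypeR R)%type.

(** Sylvester's identity for a rank-one update: multiplying [M] by the same unipotent matrix on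
    either side gives two block triangular matrices with equal determinants. *)
Lemma det_1_add_col m (w : 'cV[C]_m) (v : 'rV[C]_m) :
  \det (1%:M + w *m v) = 1 + (v *m w) 0 0.
Proof.
pose M : 'M[C]_(m + 1) := block_mx 1%:M (- w) v 1%:M.
have E1 : M *m block_mx 1%:M w 0 1%:M = block_mx 1%:M 0 v (v *m w + 1%:M).
  rewrite mulmx_block !mulmx1 !mul1mx !mulmx0 ?addr0.
  by congr block_mx; rewrite ?mul0mx ?addr0 ?subrr ?addNr.
have E2 : block_mx 1%:M w 0 1%:M *m M = block_mx (1%:M + w *m v) 0 v 1%:M.
  rewrite mulmx_block !mulmx1 !mul1mx !mul0mx ?add0r.
  by congr block_mx; rewrite ?mulmxN ?mulNmx ?mulmx1 ?mul1mx ?mul0mx ?mulmx0 ?addr0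
    ?add0r ?subrr ?addNr.
have dU : \det (block_mx 1%:M w 0 1%:M : 'M[C]_(m + 1)) = 1.
  by rewrite det_ublock !det1 mulr1.
have : \det (M *m block_mx 1%:M w 0 1%:M) = \det (block_mx 1%:M w 0 1%:M *m M).
  by rewrite !det_mulmx mulrC.
rewrite E1 E2 !det_lblock !det1 mulr1 mul1r => <-.
by rewrite det_mx11 !mxE eqxx addrC.
Qed.

Lemma posdef_gram n m (T : 'M[C]_(n, m)) : posdef (1%:M + T *m T ^t*).
Proof.
split; first by rewrite adjmxD adj1mx adjmx_mul adjmxK.
have pos k (v : 'rV[C]_k) : (v *m v ^t*) 0 0 = \sum_i `|v 0 i| ^+ 2.
  by rewrite mxE; apply: eq_bigr => i _; rewrite !mxE normCK.
move=> v v0; rewrite mulmxDr mulmxDl mulmx1 mxE mulmxA -mulmxA -adjmx_mul !pos.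
rewrite ltr_pwDl//; last by apply: sumr_ge0 => i _; rewrite exprn_ge0.
rewrite lt_def sumr_ge0 ?andbT; last by move=> i _; rewrite exprn_ge0.
apply: contraNneq v0 => /eqP; rewrite psumr_eq0; last by move=> i _; rewrite exprn_ge0.
move=> /allP h; apply/eqP/matrixP => i j; rewrite !mxE ord1.
by have /implyP/(_ isT) := h j (mem_index_enum _); rewrite sqrf_eq0 normr_eq0 => /eqP.
Qed.

(** With D = diag(L, 1) and w the column (v; l), the Gram matrix factors as [D (w w^* + 1) D^*],
    whose middle factor is a rank-one update of the identity. *)
Lemma det_gram_border n (T L : 'M[C]_n) (v : 'cV[C]_n) (l : C) :
  1%:M + T *m T ^t* = L *m L ^t* ->
  \det (1%:M + block_mx T (L *m v) 0 l%:M *m (block_mx T (L *m v) 0 l%:M) ^t*) =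
  `|\det L| ^+ 2 * (1 + `|l| ^+ 2 + (v ^t* *m v) 0 0).
Proof.
move=> TL.
pose w : 'cV[C]_(n + 1) := col_mx v l%:M.
pose D : 'M[C]_(n + 1) := block_mx L 0 0 1%:M.
have -> : 1%:M + block_mx T (L *m v) 0 l%:M *m (block_mx T (L *m v) 0 l%:M) ^t* =
   D *m (1%:M + w *m w ^t*) *m D ^t*.
  rewrite mulmxDr mulmxDl mulmx1 mulmxA -mulmxA -adjmx_mul.
  rewrite /D /w mul_block_col mul0mx addr0 mul0mx add0r mul1mx.
  rewrite !adj_block tr_col_mx map_row_mx mul_col_row !mulmx_block.
  rewrite !trmx0 !map_mx0 !adj1mx !mul0mx !mulmx0 !addr0 !add0r mulmx1.
  rewrite -TL. rewrite (@scalar_mx_block _ n 1 1).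
  rewrite !add_block_mx !add0r; congr block_mx.
    by rewrite addrA.
rewrite !det_mulmx det_1_add_col det_ublock det1 mulr1.
rewrite det_map_mx det_tr det_ublock det1 mulr1/= mulrAC normCK; congr (_ * _).
rewrite -addrA [`|l| ^+ 2 + _]addrC; congr (1 + _).
rewrite /w tr_col_mx map_row_mx mul_row_col mxE; congr (_ + _).
by rewrite tr_scalar_mx map_scalar_mx/= -scalar_mxM mxE eqxx normCK mulrC.
Qed.

Lemma adj_tvec_mul m (t : m.-tuple R2) :
  ((tvec t) ^t* *m tvec t) 0 0 = Complex (radn t) 0.
Proof.
rewrite mxE /radn (_ : Complex _ 0 = (\sum_i rad (tnth t i))%:C%C)// rmorph_sum/=.
apply: eq_bigr => i _; rewrite !mxE mulrC mul_conjC_nsq.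
by [].
Qed.


Definition hformv al be ga n (X Y : 'rV[C]_n) : R := \sum_i hform al be ga (X 0 i) (Y 0 i).

Lemma hformvE al be ga n (X Y : 'rV[C]_n) :
  hformv al be ga X Y = al * complex.Re ((X *m X ^t*) 0 0) +
    be * complex.Re ((Y *m Y ^t*) 0 0) + 2 * complex.Re (ga * (X *m Y ^t*) 0 0).
Proof.
have Re_sum (F : 'I_n -> C) : complex.Re (\sum_i F i) = \sum_i complex.Re (F i).
  by apply: (big_morph (@complex.Re R)) => // x y; rewrite ReD.
rewrite !mxE [ga * _]mulr_sumr !Re_sum !mulr_sumr -!big_split/=; apply: eq_bigr => i _.
by rewrite !mxE !mul_conjC_nsq/= mulrA.
Qed.

(** Since [L L^* = 1 + T T^*], each inner product splits into two. When [B] and [D] are left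
    eigenvectors of [T], the second one is a scalar multiple of the first. *)
Lemma hformv_gram al be ga n (L T : 'M[C]_n) (B D : 'rV[C]_n) :
  1%:M + T *m T ^t* = L *m L ^t* ->
  hformv al be ga (B *m L) (D *m L) =
  hformv al be ga B D + hformv al be ga (B *m T) (D *m T).
Proof.
move=> TL.
have E (X Y : 'rV[C]_n) : ((X *m L) *m (Y *m L) ^t*) 0 0 =
    (X *m Y ^t*) 0 0 + ((X *m T) *m (Y *m T) ^t*) 0 0.
  rewrite !adjmx_mul mulmxA -[X *m L *m L^t*]mulmxA -TL mulmxDr mulmxDl mulmx1.
  by rewrite mxE !mulmxA.
rewrite !hformvE (E B B) (E D D) (E B D) !mulrDr !ReD.
move: (_ 0 0) (_ 0 0) (_ 0 0) (_ 0 0) (_ 0 0) (_ 0 0) => u1 u2 u3 u4 u5 u6.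
ring.
Qed.

Lemma hformv_row_mx al be ga n (B D : 'rV[C]_n) x y :
  hformv al be ga (row_mx B (x%:M : 'M[C]_1)) (row_mx D (y%:M : 'M[C]_1)) =
  hformv al be ga B D + hform al be ga x y.
Proof.
rewrite /hformv big_split_ord/= big_ord1; congr (_ + _).
  by apply: eq_bigr => i _; rewrite !row_mxEl.
by rewrite !row_mxEr !mxE eqxx.
Qed.

Definition gram_det n (T : 'M[C]_n) : R := complex.Re (\det (1%:M + T *m T ^t*)).

Lemma gram_det_cholesky n (T L : 'M[C]_n) (dg : 'I_n -> R) :
  (forall i j : 'I_n, (i < j)%N -> L i j = 0) ->
  (forall i, L i i = Complex (dg i) 0) ->
  1%:M + T *m T ^t* = L *m L ^t* -> 
  `|\det L| ^+ 2 = Complex (\prod_i dg i ^+ 2) 0 /\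
  \det (1%:M + T *m T ^t*) = Complex (\prod_i dg i ^+ 2) 0.
Proof.
move=> Lt Ld TL.
have dL : \det L = Complex (\prod_i dg i) 0.
  rewrite det_trig; last exact/is_trig_mxP.
  rewrite (_ : Complex _ 0 = (\prod_i dg i)%:C%C)// rmorph_prod/=.
  by apply: eq_bigr => i _; exact: Ld.
have dL2 : `|\det L| ^+ 2 = Complex (\prod_i dg i ^+ 2) 0.
  by rewrite nsq_normE dL /nsq/= expr0n/= addr0 prodrXl.
split=> //; rewrite TL det_mulmx det_map_mx det_tr/= -normCK.
exact: dL2.
Qed.

Lemma gram_detE n (T : 'M[C]_n) :
  0 < gram_det T /\ \det (1%:M + T *m T ^t*) = Complex (gram_det T) 0.
Proof.
have [L [dg [Lt dg0 Ld TL]]] := posdef_cholesky (posdef_gram T).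
have [_ dT] := gram_det_cholesky Lt Ld TL.
by rewrite /gram_det dT/=; split=> //; apply: prodr_gt0 => i _; rewrite exprn_gt0.
Qed.

Definition border n (T : 'M[C]_n) (u : 'cV[C]_n) (l : C) : 'M[C]_(n + 1) :=
  block_mx T u 0 l%:M.

Lemma cmeasurable_gram_det d (X : measurableType d) n (F : X -> 'M[C]_n) :
  (forall i j, cmeasurable (fun x => F x i j)) ->
  measurable_fun setT (fun x => gram_det (F x)).
Proof.
move=> mF; have [] // : cmeasurable (fun x => \det (1%:M + F x *m (F x) ^t*)).
apply: cmeasurable_det => i j; under eq_fun do rewrite mxE.
apply: cmeasurableD; first exact: cmeasurable_cst.
under eq_fun do rewrite mxE; apply: cmeasurable_sum => h _.
apply: cmeasurableM => //; under eq_fun do rewrite !mxE.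
exact: cmeasurable_conj.
Qed.

(** The substitution by [L] makes the weight radial with a = 1 + |l|^2. Of the n + k + 2 powers of
    det H one is cancelled by the Jacobian, which leaves the weight of size n. *)
Lemma integral_border n (T : 'M[C]_n) (l : C) al be ga (B D : 'rV[C]_n) (r : R) k :
  hform_ge0 al be ga -> 0 <= r ->
  (\int[lpow n]_t ((r + hform al be ga ((B *m tvec t) 0 0) ((D *m tvec t) 0 0))
      * gram_det (border T (tvec t) l) ^- (n + k.+2))%:E =
   (sphere_const R n k * (1 + nsq l) ^- k.+2 *
    (gram_det T ^- (n + k.+1) *
     (r + (1 + nsq l) / k.+1%:R *
       (hformv al be ga B D + hformv al be ga (B *m T) (D *m T)))))%:E)%E.
Proof.
move=> q0 r0.
have [L [dg [Lt dg0 Ld TL]]] := posdef_cholesky (posdef_gram T).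
have [dL dT] := gram_det_cholesky Lt Ld TL.
pose de := \prod_i dg i ^+ 2.
have de0 : 0 < de by apply: prodr_gt0 => i _; rewrite exprn_gt0.
have gT : gram_det T = de by rewrite /gram_det dT.
pose a := 1 + nsq l.
have a0 : 0 < a by rewrite ltr_pwDl// nsq_ge0.
have gb t : gram_det (border T (tvec (affine_tuple L 0 t)) l) = de * (a + radn t).
  rewrite /gram_det /border tvec_affine addr0 (det_gram_border _ _ TL) dL adj_tvec_mul.
  by rewrite nsq_normE /a; simpc.
pose f t := (r + hform al be ga ((B *m tvec t) 0 0) ((D *m tvec t) 0 0))
      * gram_det (border T (tvec t) l) ^- (n + k.+2).
have mf : measurable_fun setT f.
  apply: measurable_funM.
    apply: measurable_funD => //.
    by apply: measurable_hform; exact: cmeasurable_mul_tvec.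
  apply/measurable_funV/measurable_funX/cmeasurable_gram_det => i j.
  case: (split_ordP i) => i' ->; case: (split_ordP j) => j' ->;
    under eq_fun do rewrite ?(block_mxEul, block_mxEur, block_mxEdl, block_mxEdr);
    do ?exact: cmeasurable_cst.
  exact: cmeasurable_tvec.
have f0 t : 0 <= f t.
  apply: mulr_ge0; first by rewrite addr_ge0// q0.
  by rewrite invr_ge0 exprn_ge0// ltW//; have [] := gram_detE (border T (tvec t) l).
rewrite (@ge0_integral_affine_tuple R n L dg 0 (EFin \o f))//; last exact/measurable_EFinP.
rewrite -/de /=.
(* The constant [r] is written as [r] times [hform 1 0 0] at the constant arguments 1 and 0, so that
   one spherical formula handles both summands. *)
transitivity (de%:E * \int[lpow n]_t (de ^- (n + k.+2) * r *
   (hform 1 0 0 (((0 : 'rV[C]_n) *m tvec t) 0 0 + 1) (((0 : 'rV[C]_n) *m tvec t) 0 0 + 0)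
       * (a + radn t) ^- (n + k.+2)) + de ^- (n + k.+2) * 
   (hform al be ga (((B *m L) *m tvec t) 0 0 + 0) (((D *m L) *m tvec t) 0 0 + 0)
       * (a + radn t) ^- (n + k.+2)))%:E)%E.
  congr (_ * _)%E; apply: eq_integral => t _; congr (_%:E).
  have z00 : (0 : 'M[C]_1) 0 0 = 0 by rewrite mxE.
  rewrite /f gb tvec_affine !addr0 !mulmxA !mul0mx z00 add0r.
  rewrite {2}/hform /nsq /= !(mulr0, mul0r, addr0, expr1n, expr0n)/=.
  rewrite exprMn invfM; ring.
have mq al' be' ga' (c d : 'rV[C]_n) b b' :
    measurable_fun setT (fun t : n.-tuple R2 => 
      hform al' be' ga' ((c *m tvec t) 0 0 + b) ((d *m tvec t) 0 0 + b')
       * (a + radn t) ^- (n + k.+2)).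
  apply: measurable_funM.
    by apply: measurable_hform; apply: cmeasurableD;
      do ?[exact: cmeasurable_mul_tvec|exact: cmeasurable_cst].
  by apply: measurable_funV; apply: measurable_funX; apply: measurable_funD => //;
    exact: measurable_radn.
have q1 : hform_ge0 (1 : R) 0 (0 : C).
  by move=> x y; rewrite /hform !mul0r/= !mulr0 !addr0 mul1r nsq_ge0.
have q_ge0 al' be' ga' (c d : 'rV[C]_n) b b' t : hform_ge0 al' be' ga' ->
    0 <= hform al' be' ga' ((c *m tvec t) 0 0 + b) ((d *m tvec t) 0 0 + b')
       * (a + radn t) ^- (n + k.+2).
  move=> q; apply: mulr_ge0; first exact: q.
  by rewrite invr_ge0 exprn_ge0// addr_ge0 ?radn_ge0// ltW.
have dp : 0 <= de ^- (n + k.+2) by rewrite invr_ge0 exprn_ge0// ltW.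
have mqM c0 al' be' ga' (c d : 'rV[C]_n) b b' :=
  measurable_funM (measurable_cst c0) (mq al' be' ga' c d b b').
rewrite ge0_integral_EFinD//; first last.
- by move=> t; apply: mulr_ge0 => //; exact: q_ge0.
- exact: mqM.
- by move=> t; apply: mulr_ge0; [exact: mulr_ge0|exact: q_ge0].
- exact: mqM.
rewrite !ge0_integral_EFinZ//; try (by move=> t; exact: q_ge0); try exact: mulr_ge0.
rewrite !ge0_integral_hform_spherical// -!(EFinM, EFinD); congr (_%:E).
rewrite -[\sum_i hform al be ga _ _]/(hformv al be ga (B *m L) (D *m L)) (hformv_gram _ _
  _ _ _ TL).
have h00 x y z : hform x y z 0 0 = 0.
  by rewrite /hform /nsq mulr0 mul0r/= !expr0n/= !addr0 !mulr0 !addr0.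
have h10 : @hform R 1 0 0 1 0 = 1.
  by rewrite /hform /nsq !mul0r/= mulr0 !addr0 mul1r expr1n expr0n/= addr0.
rewrite big1; last by move=> i _; rewrite !mxE h00.
rewrite h10 h00 addr0 mulr0 add0r.
rewrite gT -/a addnS exprS invfM.
have den : de ^- (n + k.+1) = (de ^+ (n + k.+1))^-1 by [].
field.
rewrite nat1r pnatr_eq0/= !lt0r_neq0 ?exprn_gt0//.
Qed.

End column_step.

(** * Left eigenvectors of the triangular factor *)

Section schur_rows.
Variable R : realType.
Local Notation C := (complex R).
Local Notation R2 := (measurableTypeR R * measurableTypeR R)%type.
Variable lam : nat -> C.

(** The packing of [schur_mx], read on sequences of any length: a single sequence describes the
    leading blocks of all sizes. *)
Definition entry (x : seq R2) (i j : nat) : C :=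
  complex_of_pair (nth (0 : R, 0 : R) x ('C(j, 2) + i)).

Definition schur_seq n (x : seq R2) : 'M[C]_n :=
  \matrix_(i, j) if (i < j)%N then entry x i j else if i == j then lam i else 0.

(** Forward substitution in [B T = lam s B]: column m expresses [(lam s - lam m) B_m] through the
    earlier coordinates, with coordinate s normalized to 1. The whole prefix is returned to make the
    recursion structural. *)
Fixpoint left_eigenseq (s : nat) (x : seq R2) (n : nat) : seq C :=
  if n is m.+1 then
    let B := left_eigenseq s x m in
    rcons B (if (m < s)%N then 0 else if m == s then 1 else
             (\sum_(i < m) B`_i * entry x i m) / (lam s - lam m))
  else [::].

Definition left_coef s x k : C := (left_eigenseq s x k.+1)`_k.

Lemma size_left_eigenseq s x n : size (left_eigenseq s x n) = n.
Proof. by elim: n => //= n IH; rewrite size_rcons IH. Qed.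

Lemma nth_left_eigenseq s x n k : (k < n)%N ->
  (left_eigenseq s x n)`_k = left_coef s x k.
Proof.
elim: n => // n IH; rewrite ltnS leq_eqVlt => /predU1P[->//|kn] /=.
by rewrite nth_rcons size_left_eigenseq kn IH.
Qed.

Lemma left_coefE s x k : left_coef s x k =
  if (k < s)%N then 0 else if k == s then 1 else
    (\sum_(i < k) left_coef s x i * entry x i k) / (lam s - lam k).
Proof.
rewrite /left_coef/= nth_rcons size_left_eigenseq ltnn eqxx.
case: ifP => // _; case: ifP => // _; congr (_ / _).
by apply: eq_bigr => i _; rewrite nth_left_eigenseq.
Qed.

Definition left_row s n x : 'rV[C]_n := \row_k left_coef s x k.

Lemma left_row_eigen s n x : (s < n)%N ->
  (forall k, (s < k < n)%N -> lam s != lam k) ->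
  left_row s n x *m schur_seq n x = lam s *: left_row s n x.
Proof.
move=> sn lamN; apply/rowP => j; rewrite !mxE.
rewrite (bigID (fun i : 'I_n => (i < j)%N))/=.
rewrite [X in _ + X](bigD1 j) ?ltnn//= [X in _ + (_ + X)]big1 ?addr0; last first.
  by move=> i /andP[ij /negPf ij']; rewrite !mxE (negPf ij) ij' mulr0.
rewrite !mxE ltnn eqxx.
have -> : \sum_(i < n | (i < j)%N) left_row s n x 0 i * schur_seq n x i j =
    \sum_(i < j) left_coef s x i * entry x i j.
  rewrite [RHS](big_ord_widen n (fun i => left_coef s x i * entry x i j)); last exact: ltnW.
  by apply: eq_bigr => i ij; rewrite !mxE ij.
have [js|sj|js] := ltngtP j s.
- rewrite (left_coefE s x j) js mul0r mulr0 addr0 big1// => i _.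
  by rewrite left_coefE (ltn_trans (ltn_ord i) js) mul0r.
- have ne : lam s - lam j != 0 by rewrite subr_eq0 lamN// sj/=.
  rewrite (left_coefE s x j) ltnNge (ltnW sj)/= gtn_eqF//.
  by field.
- rewrite (left_coefE s x j) js ltnn eqxx mul1r mulr1 big1 ?add0r// => i _.
  by rewrite left_coefE ltn_ord mul0r.
Qed.

Lemma entry_cat n (x t : seq R2) i j : size x = 'C(n, 2) -> (i < j)%N -> (j < n)%N ->
  entry (x ++ t) i j = entry x i j.
Proof.
move=> sx ij jn; rewrite /entry nth_cat sx ifT//.
apply: (@leq_trans 'C(j.+1, 2)); last exact: leq_bin2l.
by rewrite binS bin1 ltn_add2l.
Qed.

Lemma left_coef_cat n s (x t : seq R2) k : size x = 'C(n, 2) -> (k < n)%N ->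
  left_coef s (x ++ t) k = left_coef s x k.
Proof.
move=> sx; elim/ltn_ind: k => k IH kn; rewrite !left_coefE.
case: ifP => // _; case: ifP => // _; congr (_ / _); apply: eq_bigr => i _.
by rewrite (entry_cat _ sx)// IH// (ltn_trans _ kn).
Qed.

(** Because the entries are packed column by column, appending n coordinates to the sequence borders
    the matrix by one column. *)
Lemma schur_seq_cat n (x : seq R2) (t : n.-tuple R2) : size x = 'C(n, 2) ->
  schur_seq (n + 1) (x ++ t) = border (schur_seq n x) (tvec t) (lam n).
Proof.
move=> sx; apply/matrixP => i j; rewrite mxE.
case: (fintype.split_ordP i) => i' ->; case: (fintype.split_ordP j) => j' ->.
- rewrite block_mxEul mxE/= eq_lshift.
  by case: ifP => // ij; rewrite (entry_cat _ sx).
- rewrite block_mxEur mxE/= ord1 addn0 ltn_ord /entry nth_cat sx.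
  by rewrite ltnNge leq_addr/= addKn (tnth_nth (0, 0)).
- rewrite block_mxEdl mxE/= ord1 addn0 ltnNge (ltnW (ltn_ord _))/=.
  by rewrite eq_rlshift.
- by rewrite block_mxEdr !ord1 mxE/= ltnn eqxx addn0 mulr1n.
Qed.

Lemma left_row_cat s n (x : seq R2) (t : n.-tuple R2) : size x = 'C(n, 2) ->
  (s < n)%N ->
  left_row s (n + 1) (x ++ t) =
  row_mx (left_row s n x)
    ((left_row s n x *m tvec t) 0 0 / (lam s - lam n))%:M.
Proof.
move=> sx sn; apply/rowP => k; rewrite mxE.
case: (fintype.split_ordP k) => k' ->.
  by rewrite row_mxEl mxE/= (left_coef_cat _ _ sx).
rewrite row_mxEr !ord1 mxE eqxx mulr1n/= addn0 left_coefE ltnNge (ltnW sn)/= gtn_eqF//.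
congr (_ / _); rewrite mxE; apply: eq_bigr => i _; rewrite !mxE (left_coef_cat _ _ sx)//.
by rewrite /entry nth_cat sx ltnNge leq_addr/= addKn (tnth_nth (0, 0)).
Qed.

Section measurability.
Variable m : nat.

Lemma cmeasurable_entry i j : cmeasurable (fun x : m.-tuple R2 => entry x i j).
Proof.
have [im|im] := ltnP ('C(j, 2) + i) m.
  have E : (fun x : m.-tuple R2 => entry x i j) =
      (fun x => complex_of_pair (tnth x (Ordinal im))).
    by apply/funext => x; rewrite /entry (tnth_nth (0, 0)).
  rewrite E; split.
    exact: (measurableT_comp measurable_fst (measurable_tnth _)).
  exact: (measurableT_comp measurable_snd (measurable_tnth _)).
rewrite (_ : (fun _ => _) = fun=> 0); first exact: cmeasurable_cst.
by apply/funext => x; rewrite /entry nth_default ?size_tuple.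
Qed.

Lemma cmeasurable_schur_seq n i j :
  cmeasurable (fun x : m.-tuple R2 => schur_seq n x i j).
Proof.
under eq_fun do rewrite mxE; case: (i < j)%N.
  exact: cmeasurable_entry.
case: (i == j); exact: cmeasurable_cst.
Qed.

Lemma cmeasurable_left_coef s k : cmeasurable (fun x : m.-tuple R2 => left_coef s x k).
Proof.
elim/ltn_ind: k => k IH; under eq_fun do rewrite left_coefE.
case: (k < s)%N; first exact: cmeasurable_cst.
case: (k == s); first exact: cmeasurable_cst.
apply: cmeasurableM; last exact: cmeasurable_cst.
apply: cmeasurable_sum => i _; apply: cmeasurableM; first exact: IH.
exact: cmeasurable_entry.
Qed.

End measurability.
End schur_rows.

(** * Recursion over the columns *)

Section recursion.
Variable R : realType.
Local Notation C := (complex R).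
Local Notation lpow := (lebesgue_complex_power R).
Local Notation R2 := (measurableTypeR R * measurableTypeR R)%type.
Variables (lam : nat -> C) (N k : nat).
Hypothesis lam_inj : forall i j, (i < N)%N -> (j < N)%N -> i != j -> lam i != lam j.

Lemma integral_lpow_eq (m m' : nat) (f : seq R2 -> \bar R) : m = m' ->
  (\int[lpow m]_x f x = \int[lpow m']_x f x)%E.
Proof. by move=> ->. Qed.

(* Indices start at 0: left_coef lam 0 x 1 is the coefficient b, and the two
   vectors are B and b D. *)
Definition phi n al be ga (x : seq R2) : R :=
  hformv al be ga (left_row lam 0 n x) (left_coef lam 0 x 1 *: left_row lam 1 n x).

(** For [k.+1 = N] and n = N this is the determinant factor of [schur_density]; smaller n give, up
    to constants, the marginal laws of the leading blocks. *)
Definition weight n (x : seq R2) : R := gram_det (schur_seq lam n x) ^- (n + k.+1).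

Lemma weight_gt0 n x : 0 < weight n x.
Proof. by rewrite invr_gt0 exprn_gt0//; have [] := gram_detE (schur_seq lam n x). Qed.

Lemma phi_ge0 n al be ga x : hform_ge0 al be ga -> 0 <= phi n al be ga x.
Proof. by move=> q0; apply: sumr_ge0 => i _; exact: q0. Qed.

Lemma measurable_weight n m : measurable_fun setT (fun x : m.-tuple R2 => weight n x).
Proof.
apply/measurable_funV/measurable_funX/cmeasurable_gram_det => i j.
exact: cmeasurable_schur_seq.
Qed.

Lemma measurable_phi n m al be ga :
  measurable_fun setT (fun x : m.-tuple R2 => phi n al be ga x).
Proof.
apply: measurable_sum => i; apply: measurable_hform.
  by under eq_fun do rewrite mxE; exact: cmeasurable_left_coef.
under eq_fun do rewrite !mxE; apply: cmeasurableM; exact: cmeasurable_left_coef.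
Qed.

(** The conditional second moment of each coordinate of v in the column with eigenvalue [lam n]. *)
Definition growth n : R := (1 + nsq (lam n)) / k.+1%:R.

(* The factors by which E[. | T_n] multiplies |B|^2, |D|^2 and B D^*. *)
Definition factor (s s' n : nat) : C :=
  1 + Complex (growth n) 0 * (1 + lam s * (lam s')^*) /
      ((lam s - lam n) * (lam s' - lam n)^*).

Definition factor_sq (s n : nat) : R :=
  1 + growth n * (1 + nsq (lam s)) / nsq (lam s - lam n).

Lemma growth_ge0 n : 0 <= growth n.
Proof. by rewrite divr_ge0// addr_ge0// nsq_ge0. Qed.

Lemma nsq_eq0 (z : C) : (nsq z == 0) = (z == 0).
Proof.
case: z => a b; rewrite /nsq/= paddr_eq0 ?sqr_ge0// !sqrf_eq0.
by apply/andP/eqP => [[/eqP-> /eqP->]|[-> ->]].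
Qed.

Lemma nsqM (x y : C) : nsq (x * y) = nsq x * nsq y.
Proof. by case: x y => a b [c d]; rewrite /nsq/=; ring. Qed.

Lemma nsqV (x : C) : nsq x^-1 = (nsq x)^-1.
Proof.
have [->|x0] := eqVneq x 0; first by rewrite invr0 /nsq/= expr0n/= addr0 invr0.
apply: (mulfI (_ : nsq x != 0)); rewrite ?nsq_eq0//.
by rewrite divff ?nsq_eq0// -nsqM divff// /nsq/= expr1n expr0n/= addr0.
Qed.

Lemma hform_coef_pullback al be ga (x y u v : C) :
  hform (al * nsq x) (be * nsq y) (ga * x * y^*) u v = hform al be ga (x * u) (y * v).
Proof.
rewrite /hform /nsq !conjCE.
case: ga x y u v => [? ?] [? ?] [? ?] [? ?] [? ?] /=; ring.
Qed.

Lemma hform_coefD al be ga al' be' ga' (u v : C) :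
  hform (al + al') (be + be') (ga + ga') u v =
  hform al be ga u v + hform al' be' ga' u v.
Proof.
rewrite /hform /nsq !conjCE.
case: ga ga' u v => [? ?] [? ?] [? ?] [? ?] /=; ring.
Qed.

Lemma hform_coefM (c al be : R) ga (u v : C) :
  hform (c * al) (c * be) (Complex c 0 * ga) u v = c * hform al be ga u v.
Proof.
rewrite /hform /nsq !conjCE.
case: ga u v => [? ?] [? ?] [? ?] /=; ring.
Qed.

(* The rescaled coefficients are again those of a nonnegative form, being a sum of
   three pullbacks of the original one. *)
Lemma hform_step n al be ga (u v : C) :
  hform (al * factor_sq 0 n) (be * factor_sq 1 n) (ga * factor 0 1 n) u v =
  hform al be ga u v + growth n *
   (hform al be ga ((lam 0 - lam n)^-1 * u) ((lam 1 - lam n)^-1 * v) +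
    hform al be ga ((lam 0 - lam n)^-1 * lam 0 * u) ((lam 1 - lam n)^-1 * lam 1 * v)).
Proof.
rewrite -!hform_coef_pullback -hform_coefD -hform_coefM -hform_coefD.
congr (hform _ _ _ _ _).
- rewrite /factor_sq !nsqM nsqV; ring.
- rewrite /factor_sq !nsqM nsqV; ring.
- rewrite /factor !rmorphM !fmorphV invfM/=; ring.
Qed.

Lemma hform_step_ge0 n al be ga : hform_ge0 al be ga ->
  hform_ge0 (al * factor_sq 0 n) (be * factor_sq 1 n) (ga * factor 0 1 n).
Proof.
move=> q0 u v; rewrite hform_step; apply: addr_ge0; first exact: q0.
by rewrite mulr_ge0 ?growth_ge0// addr_ge0//; exact: q0.
Qed.

(** For n > 1 the coefficient b is already determined by [x], so the new column only adds one
    coordinate to each vector, linear in [t]. *)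
Lemma phi_cat n al be ga x (t : n.-tuple R2) : size x = 'C(n, 2) -> (1 < n)%N ->
  phi (n + 1) al be ga (x ++ t) = phi n al be ga x +
    hform al be ga
      ((((lam 0 - lam n)^-1 *: left_row lam 0 n x) *m tvec t) 0 0)
      ((((lam 1 - lam n)^-1 *: (left_coef lam 0 x 1 *: left_row lam 1 n x)) *m tvec t) 0 0).
Proof.
move=> sx n1; rewrite /phi !(left_row_cat _ _ sx) ?(ltnW n1)// (left_coef_cat _ _ _ sx)//.
rewrite scale_row_mx scale_scalar_mx hformv_row_mx; congr (_ + hform _ _ _ _ _).
  by rewrite -scalemxAl [RHS]mxE mulrC.
by rewrite -!scalemxAl [RHS]mxE [in RHS]mxE; ring.
Qed.

Definition step_const n : R := sphere_const R n k * (1 + nsq (lam n)) ^- k.+2.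

Lemma step_const_gt0 n : 0 < step_const n.
Proof.
by rewrite mulr_gt0 ?sphere_const_gt0// invr_gt0 exprn_gt0// ltr_pwDl// nsq_ge0.
Qed.

Lemma integral_last_column n x al be ga (r : R) : size x = 'C(n, 2) -> (1 < n)%N ->
  (n < N)%N -> hform_ge0 al be ga -> 0 <= r ->
  (\int[lpow n]_t ((r + phi (n + 1) al be ga (x ++ t)) * weight (n + 1) (x ++ t))%:E =
   (step_const n * ((r + phi n (al * factor_sq 0 n) (be * factor_sq 1 n) (ga * factor 0 1
     n) x)
      * weight n x))%:E)%E.
Proof.
move=> sx n1 nN q0 r0.
under eq_integral => t _.
  rewrite (phi_cat _ _ _ _ sx)// /weight (schur_seq_cat _ _ sx) addrA -addnA add1n.
  over.
rewrite integral_border//; last by rewrite addr_ge0// phi_ge0.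
rewrite /step_const /weight; congr (_%:E).
rewrite -!mulrA; congr (_ * (_ * _)); rewrite mulrC; congr (_ * _).
rewrite -addrA; congr (_ + _).
(* Both vectors are left eigenvectors of T_n, so multiplying them by T_n only rescales them and the
   sum regroups as in [hform_step]. *)
rewrite -!scalemxAl !left_row_eigen//; first last.
- move=> j /andP[sj jn]; apply: lam_inj (ltn_trans jn nN) _; last by rewrite ltn_eqF.
  exact: ltn_trans (ltn_trans sj jn) nN.
- exact: ltnW.
- move=> j /andP[sj jn]; apply: lam_inj (ltn_trans jn nN) _; last by rewrite ltn_eqF.
  exact: ltn_trans (ltn_trans sj jn) nN.
rewrite /phi /hformv mulrA -[X in _ * X]big_split mulr_sumr -big_split/=.
apply: eq_bigr => i _; rewrite hform_step.
have sE (c : C) (A : 'rV[C]_n) : (c *: A) 0 i = c * A 0 i by rewrite mxE.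
by rewrite !sE; congr (_ + growth n * (_ + hform _ _ _ _ _)); ring.
Qed.

Lemma integral_step n al be ga (r : R) : (1 < n)%N -> (n < N)%N ->
  hform_ge0 al be ga -> 0 <= r ->
  (\int[lpow 'C(n.+1, 2)]_x ((r + phi n.+1 al be ga x) * weight n.+1 x)%:E =
   (step_const n)%:E * \int[lpow 'C(n, 2)]_x
     ((r + phi n (al * factor_sq 0 n) (be * factor_sq 1 n) (ga * factor 0 1 n) x)
        * weight n x)%:E)%E.
Proof.
move=> n1 nN q0 r0.
rewrite (@integral_lpow_eq 'C(n.+1, 2) ('C(n, 2) + n)
  (fun x => ((r + phi n.+1 al be ga x) * weight n.+1 x)%:E)); last first.
  by rewrite binS bin1.
rewrite (@ge0_integral_cat R 'C(n, 2) n
  (fun x => ((r + phi n.+1 al be ga x) * weight n.+1 x)%:E)); last 2 first.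
- apply/measurable_EFinP/measurable_funM; last exact: measurable_weight.
  by apply: measurable_funD => //; exact: measurable_phi.
- by move=> x; rewrite lee_fin mulr_ge0 ?addr_ge0 ?phi_ge0// ltW// weight_gt0.
rewrite -ge0_integral_EFinZ; first last.
- move=> x; rewrite mulr_ge0 ?addr_ge0 ?phi_ge0// ?ltW ?weight_gt0//.
  exact: hform_step_ge0.
- apply: measurable_funM; last exact: measurable_weight.
  by apply: measurable_funD => //; exact: measurable_phi.
- exact/ltW/step_const_gt0.
apply: eq_integral => x _.
rewrite -(integral_last_column _ n1 nN q0 r0) ?size_tuple//.
by rewrite addn1.
Qed.

(** At n = 2 the two vectors are (1, b) and (0, b). The first coordinate contributes [al], and the
    second the form at (b, b), which is |b|^2 times its value at (1, 1). *)
Lemma integral_base al be ga (r : R) : (1 < N)%N ->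
  hform_ge0 al be ga -> 0 <= r ->
  (\int[lpow 'C(2, 2)]_x ((r + phi 2 al be ga x) * weight 2 x)%:E =
   (step_const 1 * weight 1 [::] * (r + al + growth 1 * (1 + nsq (lam 0)) / nsq (lam 0 -
     lam 1)
       * hform al be ga 1 1))%:E)%E.
Proof.
move=> N1 q0 r0.
have s0 : size ([::] : seq R2) = 'C(1, 2) by [].
pose B : 'rV[C]_1 := (lam 0 - lam 1)^-1 *: left_row lam 0 1 [::].
have Beig : B *m schur_seq lam 1 [::] = lam 0 *: B.
  rewrite /B -scalemxAl left_row_eigen//; first by rewrite !scalerA mulrC.
  by move=> [|j].
have B00 : B 0 0 = (lam 0 - lam 1)^-1 by rewrite !mxE left_coefE mulr1.
have al0 : 0 <= al.
  have := q0 1 0; rewrite /hform /nsq rmorph0 mulr0/= !expr0n expr1n/= !addr0.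
  by rewrite mulr1 !mulr0 !addr0.
have phi2 (t : 1.-tuple R2) : phi 2 al be ga t =
    al + hform al be ga ((B *m tvec t) 0 0) ((B *m tvec t) 0 0).
  have b2 : left_coef lam 0 t 1 = (B *m tvec t) 0 0.
    rewrite left_coefE/= big_ord1 left_coefE/= mul1r mxE big_ord1 B00 mulrC mxE.
    by rewrite /entry (tnth_nth (0, 0)).
  rewrite /phi /hformv big_ord_recl big_ord1 !mxE/= b2.
  rewrite !(left_coefE lam 1)/= !(left_coefE lam 0 t 0)/= mulr0 mulr1; congr (_ + _).
  by rewrite /hform /nsq rmorph0 mulr0/= !expr0n expr1n/= !addr0 mulr1 !mulr0 !addr0.
  by rewrite !mxE.
rewrite (@integral_lpow_eq 'C(2, 2) 1
  (fun x => ((r + phi 2 al be ga x) * weight 2 x)%:E))//.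
have weight2 (t : 1.-tuple R2) : weight 2 t =
    gram_det (border (schur_seq lam 1 [::]) (tvec t) (lam 1)) ^- (1 + k.+2).
  by rewrite -(schur_seq_cat lam t s0).
transitivity (\int[lpow 1]_t
   ((r + al + hform al be ga ((B *m tvec t) 0 0) ((B *m tvec t) 0 0)) *
    gram_det (border (schur_seq lam 1 [::]) (tvec t) (lam 1)) ^- (1 + k.+2))%:E)%E.
  apply: eq_integral => t _; by rewrite phi2 weight2 addrA.
rewrite integral_border ?addr_ge0// Beig /step_const /weight.
congr (_%:E); rewrite -!mulrA; do 4!congr (_ * _); congr (_ + _).
have lB00 : (lam 0 *: B) 0 0 = lam 0 * (lam 0 - lam 1)^-1 by rewrite mxE B00.
congr (_ * (_ * _)).
have hformv1 (X Y : 'rV[C]_1) : hformv al be ga X Y = hform al be ga (X 0 0) (Y 0 0).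
  exact: big_ord1.
rewrite !hformv1 lB00 B00.
have e z : hform al be ga z z = nsq z * hform al be ga 1 1.
  by rewrite -hform_homog !mul1r.
by rewrite !(e (lam 0 - lam 1)^-1) (e (lam 0 * _)) nsqM nsqV; ring.
Qed.

(** The constant [c] is chosen before the form and [r], hence is common to the partition function
    and to the forms that encode the overlap, and cancels in their quotient. *)
Lemma integral_phi_weight n : (1 < n <= N)%N -> exists2 c : R, 0 < c &
  forall al be ga (r : R), hform_ge0 al be ga -> 0 <= r ->
  (\int[lpow 'C(n, 2)]_x ((r + phi n al be ga x) * weight n x)%:E =
   (c * (r + al * (\prod_(2 <= j < n) factor_sq 0 j) +
      growth 1 * (1 + nsq (lam 0)) / nsq (lam 0 - lam 1) *
      hform (al * \prod_(2 <= j < n) factor_sq 0 j)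
            (be * \prod_(2 <= j < n) factor_sq 1 j)
            (ga * \prod_(2 <= j < n) factor 0 1 j) 1 1))%:E)%E.
Proof.
elim: n => // n IH; rewrite ltnS leq_eqVlt => /andP[/predU1P[<-|n1] nN].
  exists (step_const 1 * weight 1 [::]).
    by rewrite mulr_gt0 ?step_const_gt0 ?weight_gt0.
  by move=> al be ga r q0 r0; rewrite integral_base// !big_geq// !mulr1.
have [|c c0 IHc] := IH; first by rewrite n1 ltnW.
exists (step_const n * c); first by rewrite mulr_gt0 ?step_const_gt0.
move=> al be ga r q0 r0; rewrite integral_step// IHc//; last exact: hform_step_ge0.
rewrite -EFinM !big_nat_recr//= -[in RHS]mulrA; congr (_ * (_ * _))%:E.
have e (z x y : R) : z * y * x = z * (x * y) by ring.
have ec (z x y : C) : z * y * x = z * (x * y) by ring.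
by rewrite !e ec.
Qed.

End recursion.

(** * Overlaps *)

Section overlap_algebra.
Variable R : realType.
Local Notation C := (complex R).
Local Notation R2 := (measurableTypeR R * measurableTypeR R)%type.
Local Open Scope classical_set_scope.

(** [K = L1 R2] relates two diagonalizations with the same distinct eigenvalues, so it is diagonal.
    The factor that it puts on the row product of one pair is the factor that it puts on the column
    product of the other. *)
Lemma is_overlap_uniq N (G : 'M[C]_N) (lam : 'I_N -> C) i j o o' :
  injective lam -> is_overlap G lam i j o -> is_overlap G lam i j o' -> o = o'.
Proof.
move=> lam_inj [L1 [R1 [[GR1 LG1 LR1] ->]]] [L2 [R2 [[GR2 LG2 LR2] ->]]].
pose K := L1 *m R2.
have Kd a b : a != b -> K a b = 0.
  move=> ab.
  have e : (row a L1 *m G *m col b R2) 0 0 = (row a L1 *m (G *m col b R2)) 0 0.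
    by rewrite mulmxA.
  have Kab : (row a L1 *m col b R2) 0 0 = K a b.
    by rewrite !mxE; apply: eq_bigr => h _; rewrite !mxE.
  move: e; rewrite LG1 GR2 -scalemxAl -scalemxAr mxE [RHS]mxE Kab => /eqP.
  rewrite -subr_eq0 -mulrBl mulf_eq0 subr_eq0 => /orP[/eqP/lam_inj/eqP|/eqP//].
  by rewrite (negPf ab).
have RL2 : R2 *m L2 = 1%:M by exact: mulmx1C.
have RL1 : R1 *m L1 = 1%:M by exact: mulmx1C.
have rowE a : row a L1 = K a a *: row a L2.
  have -> : L1 = K *m L2 by rewrite /K -mulmxA RL2 mulmx1.
  apply/rowP => b; rewrite [LHS]mxE [LHS]mxE [RHS]mxE [X in _ = _ * X]mxE.
  rewrite (bigD1 a)//= big1 ?addr0// => h ha.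
  by rewrite Kd 1?eq_sym// mul0r.
have colE b : col b R2 = K b b *: col b R1.
  have -> : R2 = R1 *m K by rewrite /K mulmxA RL1 mul1mx.
  apply/colP => a; rewrite [LHS]mxE [LHS]mxE [RHS]mxE [X in _ = _ * X]mxE.
  rewrite (bigD1 b)//= big1 ?addr0 1?mulrC// => h hb.
  by rewrite Kd// mulr0.
have adjZ m n (c : C) (A : 'M[C]_(m, n)) : (c *: A) ^t* = c^* *: A ^t*.
  by rewrite linearZ/= map_mxZ.
have -> : (row i L1 *m (row j L1) ^t*) 0 0 =
    K i i * (K j j)^* * (row i L2 *m (row j L2) ^t*) 0 0.
  by rewrite (rowE i) (rowE j) adjZ -scalemxAl -scalemxAr scalerA [LHS]mxE.
have -> : ((col j R2) ^t* *m col i R2) 0 0 =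
    K i i * (K j j)^* * ((col j R1) ^t* *m col i R1) 0 0.
  rewrite (colE i) (colE j) adjZ -scalemxAl -scalemxAr scalerA [LHS]mxE.
  by congr (_ * _); exact: mulrC.
move: (K i i) ((K j j)^*) => a b.
by rewrite -[LHS]mulrA mulrCA.
Qed.

(** The pair [L U^*], [U L^-1] diagonalizes [U T U^*], and [U] drops out of the inner products. By
    uniqueness [xget] returns the overlap of this pair, not its default value. *)
Lemma overlap_unitary N (T U : 'M[C]_N) (lam : 'I_N -> C) (L : 'M[C]_N) i j :
  injective lam -> U \is unitarymx -> L \in unitmx ->
  (forall a, row a L *m T = lam a *: row a L) ->
  overlap (U *m T *m U ^t*) lam i j =
  (row i L *m (row j L) ^t*) 0 0 * ((col j (invmx L)) ^t* *m col i (invmx L)) 0 0.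
Proof.
move=> lam_inj Uu Lu LT; set G := U *m T *m _; set o := _ * _.
have UU : U ^t* *m U = 1%:M by apply: mulmx1C; exact/unitarymxP.
have cU a : col a (U *m invmx L) = U *m col a (invmx L) by rewrite !colE mulmxA.
pose D : 'M[C]_N := diag_mx (\row_a lam a).
have LD : L *m T = D *m L.
  apply/row_matrixP => a; rewrite row_mul LT row_mul row_diag_mx mxE.
  by rewrite -scalemxAl -rowE.
have TX : T *m invmx L = invmx L *m D.
  by rewrite -[T](mulKmx Lu) LD -mulmxA mulmxK.
have ho : is_overlap G lam i j o.
  exists (L *m U ^t*), (U *m invmx L); split.
    split.
    - move=> a; rewrite cU /G !mulmxA -(mulmxA _ (U ^t*) U) UU mulmx1 -mulmxA.
      rewrite [col a _]colE [T *m _]mulmxA TX -mulmxA !scalemxAr; congr (_ *m _).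
      congr (_ *m _); rewrite mul_diag_mx.
      apply/matrixP => i' j'; rewrite !mxE.
      by case: eqP => [->//|_]; rewrite !mulr0.
    - move=> a; rewrite row_mul /G !mulmxA -(mulmxA _ (U ^t*) U) UU mulmx1 LT.
      by rewrite -scalemxAl.
    - by rewrite mulmxA -(mulmxA L) UU mulmx1 mulmxV.
  rewrite /o; congr (_ * _).
    by rewrite !row_mul adjmx_mul adjmxK mulmxA -(mulmxA _ (U ^t*) U) UU mulmx1.
  by rewrite !cU adjmx_mul mulmxA -(mulmxA _ (U ^t*) U) UU mulmx1.
apply: xget_subset1 => //= a b; exact: is_overlap_uniq.
Qed.

End overlap_algebra.

(** * The overlap as an explicit function of the triangular entries *)

Section schur_overlap.
Variable R : realType.
Local Notation C := (complex R).
Local Notation R2 := (measurableTypeR R * measurableTypeR R)%type.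
Variables (N : nat) (lam : 'I_N -> C).
Hypothesis lam_inj : injective lam.

Definition lam_nat (n : nat) : C := if insub n is Some i then lam i else 0.

Lemma lam_natE (i : 'I_N) : lam_nat i = lam i.
Proof. by rewrite /lam_nat valK. Qed.

Lemma lam_nat_inj a b : (a < N)%N -> (b < N)%N -> a != b ->
  lam_nat a != lam_nat b.
Proof.
move=> aN bN; apply: contra => /eqP.
by rewrite (lam_natE (Ordinal aN)) (lam_natE (Ordinal bN)) => /lam_inj[->].
Qed.

Lemma schur_mx_seq (x : 'C(N, 2).-tuple R2) : schur_mx lam x = schur_seq lam_nat N x.
Proof. by apply/matrixP => i j; rewrite !mxE lam_natE. Qed.

Definition left_mx (x : seq R2) : 'M[C]_N := \matrix_(i, j) left_coef lam_nat i x j.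

Lemma row_left_mx x i : row i (left_mx x) = left_row lam_nat i N x.
Proof. by apply/rowP => j; rewrite !mxE. Qed.

Lemma left_mx_eigen x i :
  row i (left_mx x) *m schur_seq lam_nat N x = lam i *: row i (left_mx x).
Proof.
rewrite row_left_mx -lam_natE left_row_eigen// => j /andP[ij jN].
by apply: lam_nat_inj => //; rewrite ltn_eqF.
Qed.

Lemma left_mx_unit x : left_mx x \in unitmx.
Proof.
rewrite unitmxE -det_tr det_trig.
  by rewrite big1 ?unitr1// => i _; rewrite !mxE left_coefE ltnn eqxx.
by apply/is_trig_mxP => i j ij; rewrite !mxE left_coefE ij.
Qed.

(** The left eigenvector matrix is unipotent upper triangular, so its inverse fixes the first basis
    vector and sends the second to itself minus b times the first. The right eigenvectors therefore
    contribute [- b^*]. *)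
Lemma overlap_schur_seq (U : 'M[C]_N) x (i0 i1 : 'I_N) : i0 = 0%N :> nat -> i1 =
  1%N :> nat ->
  U \is unitarymx ->
  overlap (U *m schur_seq lam_nat N x *m U ^t*) lam i0 i1 =
  - (left_row lam_nat 0 N x *m
       (left_coef lam_nat 0 x 1 *: left_row lam_nat 1 N x) ^t*) 0 0.
Proof.
move=> e0 e1 Uu; set b := left_coef _ _ _ _.
rewrite (overlap_unitary i0 i1 lam_inj Uu (left_mx_unit x) (left_mx_eigen x)).
rewrite !row_left_mx e0 e1.
have L0 : left_mx x *m delta_mx i0 0 = (delta_mx i0 0 : 'cV[C]_N).
  apply/colP => i; rewrite -colE !mxE left_coefE e0 eqxx andbT.
  by rewrite -val_eqE/= e0; case: (nat_of_ord i).
have L1 : left_mx x *m delta_mx i1 0 = (delta_mx i1 0 + b *: delta_mx i0 0 : 'cV[C]_N).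
  apply/colP => i; rewrite -colE !mxE !eqxx !andbT -!val_eqE/= e0 e1.
  case: (nat_of_ord i) => [|[|j]] /=; rewrite ?mulr1 ?mulr0 ?add0r ?addr0//.
have X0 : invmx (left_mx x) *m delta_mx i0 0 = (delta_mx i0 0 : 'cV[C]_N).
  by rewrite -{1}L0 mulKmx// left_mx_unit.
have X1 : invmx (left_mx x) *m delta_mx i1 0 =
  (delta_mx i1 0 - b *: delta_mx i0 0 : 'cV[C]_N).
  have := mulKmx (left_mx_unit x) (delta_mx i1 0 : 'cV[C]_N).
  by rewrite L1 mulmxDr -scalemxAr X0 => h; rewrite -{2}h addrK.
rewrite !colE X0 X1.
have -> : ((delta_mx i1 0 - b *: delta_mx i0 0 : 'cV[C]_N) ^t* *m (delta_mx i0 0 :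
  'cV[C]_N)) 0 0 = - b^*.
  rewrite -colE !mxE !eqxx/= mulr1.
  have -> : (i0 == i1) = false by rewrite -val_eqE/= e0 e1.
  by rewrite sub0r rmorphN.
by rewrite linearZ/= map_mxZ -scalemxAr [in RHS]mxE mulrN mulrC.
Qed.

End schur_overlap.

(** * The quenched expectation *)

Section assembly.
Variable R : realType.
Local Notation C := (complex R).
Local Notation lpow := (lebesgue_complex_power R).
Local Notation R2 := (measurableTypeR R * measurableTypeR R)%type.

Lemma ge0_integrable_val d (T : measurableType d) (mu : {measure set T -> \bar R})
    (f : T -> R) (v : R) :
  measurable_fun setT f -> (forall x, 0 <= f x) ->
  (\int[mu]_x (f x)%:E = v%:E)%E ->
  mu.-integrable setT (EFin \o f) /\ \int[mu]_x f x = v.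
Proof.
move=> mf f0 fv; split; last by rewrite /Rintegral fv.
apply/integrableP; split; first exact/measurable_EFinP.
under eq_integral do rewrite /= ger0_norm//.
by rewrite fv ltry.
Qed.

Lemma hform_ge0_unit (ga : C) : nsq ga = 1 -> hform_ge0 1 1 ga.
Proof.
move=> g1 x y; rewrite (_ : hform 1 1 ga x y = nsq (ga * x + y)) ?nsq_ge0//.
transitivity (hform (nsq ga) 1 ga x y); first by rewrite g1.
rewrite /hform /nsq !conjCE.
by case: ga x y {g1} => [? ?] [? ?] [? ?] /=; ring.
Qed.

(** [V] is the squared modulus of the Vandermonde determinant. It depends on the spectrum alone and
    is positive because the eigenvalues are distinct. *)
Lemma schur_density_seq N (lam : 'I_N -> C) (k : nat) :
  injective lam -> k.+1 = N ->
  exists2 V : R, 0 < V &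
  forall x : 'C(N, 2).-tuple R2, schur_density (schur_mx lam x) =
    V * weight (lam_nat lam) k N x.
Proof.
move=> lam_inj kN.
exists (\prod_(i < N) \prod_(j < N | (i < j)%N) nsq (lam i - lam j)).
  apply: prodr_gt0 => i _; apply: prodr_gt0 => j ij.
  rewrite lt_def nsq_ge0 nsq_eq0 subr_eq0 andbT; apply: contraTneq ij => /lam_inj->.
  by rewrite ltnn.
move=> y; rewrite /schur_density.
have [g0 gE] := gram_detE (schur_mx lam y).
rewrite gE.
rewrite (_ : \prod_(i < N) _ = (\prod_(i < N) \prod_(j < N | (i < j)%N) nsq (lam i - lam
  j))%:C%C); last first.
  rewrite rmorph_prod; apply: eq_bigr => i _; rewrite rmorph_prod; apply: eq_bigr => j _.
  by rewrite !mxE !ltnn !eqxx nsq_normE.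
rewrite (_ : Complex (gram_det _) 0 = (gram_det (schur_mx lam y))%:C%C)//.
rewrite -rmorphXn -fmorphV -rmorphM/= /weight schur_mx_seq.
by rewrite kN mul2n addnn.
Qed.

Lemma integrable_mulB d (T : measurableType d) (mu : {measure set T -> \bar R})
    (f g : T -> R) (c a b : R) :
  mu.-integrable setT (EFin \o f) /\ \int[mu]_x f x = a ->
  mu.-integrable setT (EFin \o g) /\ \int[mu]_x g x = b ->
  mu.-integrable setT (EFin \o (fun x => c * (f x - g x))) /\
  \int[mu]_x (c * (f x - g x)) = c * (a - b).
Proof.
move=> [fi <-] [gi <-].
have di : mu.-integrable setT (EFin \o (fun x => f x - g x)).
  rewrite (_ : _ \o _ = ((EFin \o f) \- (EFin \o g))%E); last first.
    by apply/funext => x /=; rewrite EFinB.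
  exact: integrableB.
split; last by rewrite RintegralZl// RintegralB.
rewrite (_ : _ \o _ = (fun x => c%:E * (f x - g x)%:E)%E).
  exact: integrableZl.
by apply/funext => x /=; rewrite EFinM.
Qed.

End assembly.


Theorem theorem2p11 (R : realType) (N : nat) (hN : (1 < N)%N)
    (lam : 'I_N -> complex R) (hlam : injective lam)
    (U : 'M[complex R]_N -> 'M[complex R]_N)
    (hU : forall T, U T \is unitarymx) :
  let l1 := Ordinal (ltnW hN) in
  let l2 := Ordinal hN in
  let O12 := fun T => overlap (U T *m T *m (U T) ^t*) lam l1 l2 in
  quenched_integrable lam O12 /\
  quenched_expectation lam O12 =
    (1 + `|lam l1| ^+ 2) * (1 + `|lam l2| ^+ 2) *
    (- (N%:R * `|lam l1 - lam l2| ^+ 2)^-1 *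
     \prod_(k < N | (1 < k)%N)
       (1 + (1 + lam l1 * (lam l2)^*) * (1 + `|lam k| ^+ 2) /
            (N%:R * (lam l1 - lam k) * (lam l2 - lam k)^*))).

Proof.
move=> l1 l2 O12.
pose k := N.-1; have kN : k.+1 = N by rewrite prednK// ltnW.
pose ln := lam_nat lam.
have [V V0 wE] := schur_density_seq hlam kN.
have [|c c0 IE] := integral_phi_weight (n := N) k (lam_nat_inj hlam).
  by rewrite hN leqnn.
pose P0 : R := \prod_(2 <= j < N) factor_sq ln k 0 j.
pose P1 : R := \prod_(2 <= j < N) factor_sq ln k 1 j.
pose Pr : complex R := \prod_(2 <= j < N) factor ln k 0 1 j.
(* [E] is the quenched mean of |b|^2. As [growth ln k 1] contains 1 + |l2|^2, it supplies the whole
   prefactor (1 + |l1|^2) (1 + |l2|^2) / (N |l1 - l2|^2). *)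
pose E : R := growth ln k 1 * (1 + nsq (ln 0)) / nsq (ln 0 - ln 1).
pose wt (x : seq (measurableTypeR R * measurableTypeR R)) := weight ln k N x.
pose F ga (x : 'C(N, 2).-tuple (measurableTypeR R * measurableTypeR R)) : R :=
  V * (phi ln N 1 1 ga x * wt x).
have wt0 x : 0 <= wt x by rewrite ltW// weight_gt0.
have Fval ga : hform_ge0 1 1 ga ->
   (lebesgue_complex_power R 'C(N, 2)).-integrable setT (EFin \o F ga) /\
   \int[lebesgue_complex_power R 'C(N, 2)]_x F ga x =
     V * (c * (P0 + E * hform P0 P1 (ga * Pr) 1 1)).
  move=> q0; apply: ge0_integrable_val.
  - apply: measurable_funM => //; apply: measurable_funM; last exact: measurable_weight.
    exact: measurable_phi.
  - by move=> x; rewrite !mulr_ge0 ?phi_ge0// ltW.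
  rewrite /F ge0_integral_EFinZ//; first last.
  - by move=> x; rewrite mulr_ge0 ?phi_ge0.
  - by apply: measurable_funM; [exact: measurable_phi|exact: measurable_weight].
  - exact: ltW.
  have h := IE 1 1 ga 0 q0 (lexx _); rewrite !mul1r add0r in h.
  rewrite [RHS]EFinM; congr (_ * _)%E; apply: etrans _ h.
  by apply: eq_integral => x _; rewrite add0r.
have hz x y : @hform R 0 0 0 x y = 0 by rewrite /hform !mul0r/= mulr0 !addr0.
have q00 : @hform_ge0 R 0 0 0 by move=> x y; rewrite hz.
have q110 : @hform_ge0 R 1 1 0.
  by move=> x y; rewrite /hform !mul0r/= mulr0 addr0 !mul1r addr_ge0// nsq_ge0.
have [wi wv] : (lebesgue_complex_power R 'C(N, 2)).-integrable setT
     (EFin \o (fun x => schur_density (schur_mx lam x))) /\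
   \int[lebesgue_complex_power R 'C(N, 2)]_x schur_density (schur_mx lam x) = V * c.
  apply: ge0_integrable_val.
  - by under eq_fun do rewrite wE; apply: measurable_funM => //; exact: measurable_weight.
  - by move=> x; rewrite wE mulr_ge0// ltW.
  under eq_integral do rewrite wE.
  rewrite ge0_integral_EFinZ//; [|exact: ltW|exact: measurable_weight].
  (* The zero form with r = 1 leaves the bare weight and yields the partition function. *)
  have h := IE 0 0 0 1 q00 ler01; rewrite !mul0r addr0 hz mulr0 addr0 mulr1 in h.
  rewrite [RHS]EFinM; congr (_ * _)%E; apply: etrans _ h.
  apply: eq_integral => x _; congr (_%:E).
  by rewrite /phi /hformv big1 ?addr0 ?mul1r// => i _; rewrite hz.
have OE x : O12 (schur_mx lam x) = - (left_row ln 0 N x *m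
       (left_coef ln 0 x 1 *: left_row ln 1 N x) ^t*) 0 0.
  by rewrite /O12 schur_mx_seq (overlap_schur_seq hlam).
have reX ga x : 2 * complex.Re (ga * (left_row ln 0 N x *m
       (left_coef ln 0 x 1 *: left_row ln 1 N x) ^t*) 0 0) =
         phi ln N 1 1 ga x - phi ln N 1 1 0 x.
  by rewrite /phi !hformvE mul0r/= mulr0 addr0 addrAC subrr add0r.
(* Subtracting the form with zero off-diagonal coefficient removes [P0] and [P1], so only the
   factors of B D^* remain. *)
have hdiff ga : hform P0 P1 (ga * Pr) 1 1 - hform P0 P1 (0 * Pr) 1 1 =
  2 * complex.Re (ga * Pr).
  by rewrite /hform !mul0r rmorph1 !mulr1/= mulr0 addr0 addrAC subrr add0r.
have ReN (z : complex R) : complex.Re (- z) = - complex.Re z by case: z.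
have ImN (z : complex R) : complex.Im (- z) = - complex.Im z by case: z.
(* [mi] is -i: its form isolates the imaginary part, as the form with coefficient 1 isolates the
   real part. *)
pose mi : complex R := Complex 0 (-1).
have mi1 : nsq mi = 1 by rewrite /nsq/= expr0n/= add0r sqrrN expr1n.
have miE z : complex.Re (mi * z) = complex.Im z by case: z => a b; rewrite ReM/=; ring.
have n1 : nsq (1 : complex R) = 1 by rewrite /nsq/= expr0n/= addr0 expr1n.
(* The factor -1/2 combines the sign in [OE] with the coefficient 2 of the real part in [hform]. *)
have [Ri Rv] := integrable_mulB (- 2^-1) (Fval 1 (hform_ge0_unit n1)) (Fval 0 q110).
have [Ii Iv] := integrable_mulB (- 2^-1) (Fval mi (hform_ge0_unit mi1)) (Fval 0 q110).
have ReOE : (fun x => complex.Re (O12 (schur_mx lam x)) * schur_density (schur_mx lam x)) =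
    (fun x => - 2^-1 * (F 1 x - F 0 x)).
  apply/funext => y; by rewrite OE wE ReN /F -mulrBr -mulrBl -reX mul1r /wt; field.
have ImOE : (fun x => complex.Im (O12 (schur_mx lam x)) * schur_density (schur_mx lam x)) =
    (fun x => - 2^-1 * (F mi x - F 0 x)).
  apply/funext => y; by rewrite OE wE ImN /F -mulrBr -mulrBl -reX miE /wt; field.
split.
  split=> //; first by rewrite wv mulr_gt0.
  - by rewrite ReOE.
  - by rewrite ImOE.
have valE ga : - 2^-1 * (V * (c * (P0 + E * hform P0 P1 (ga * Pr) 1 1)) -
    V * (c * (P0 + E * hform P0 P1 (0 * Pr) 1 1))) / (V * c) = - E * complex.Re (ga * Pr).
  rewrite -!mulrBr opprD addrACA subrr add0r -mulrBr hdiff; field.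
  by rewrite !lt0r_neq0.
rewrite /quenched_expectation wv ReOE ImOE Rv Iv !valE mul1r miE.
have -> : Complex (- E * complex.Re Pr) (- E * complex.Im Pr) = - E%:C%C * Pr.
  by case: (Pr) => a b; simpc.
have l1E : lam l1 = ln 0 by rewrite -(lam_natE lam l1).
have l2E : lam l2 = ln 1 by rewrite -(lam_natE lam l2).
have -> : \prod_(j < N | (1 < j)%N) (1 + (1 + lam l1 * (lam l2)^*) * (1 + `|lam j| ^+ 2) /
            (N%:R * (lam l1 - lam j) * (lam l2 - lam j)^*)) = Pr.
  rewrite /Pr big_geq_mkord; apply: eq_bigr => j _.
  rewrite l1E l2E -lam_natE nsq_normE -/ln /factor /growth kN.
  have -> : Complex ((1 + nsq (ln j)) / N%:R) 0 = (1 + Complex (nsq (ln j)) 0) / N%:R.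
    rewrite -[LHS]/((1 + nsq (ln j)) / N%:R)%:C%C rmorphM fmorphV rmorph_nat rmorphD
      rmorph1.
    by [].
  by rewrite !invfM; ring.
rewrite mulrA; congr (_ * _).
rewrite l1E l2E !nsq_normE /E /growth kN.
move: (nsq (ln 0)) (nsq (ln 1)) (nsq (ln 0 - ln 1)) => a b d.
rewrite -[Complex a 0]/a%:C%C -[Complex b 0]/b%:C%C -[Complex d 0]/d%:C%C.
by rewrite !(rmorphM, fmorphV, rmorph_nat, rmorphD, rmorph1) !invfM/=; ring.
Qed.
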